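(* Equip $\mathbb{R}^4\times S^3$ with the BGGG $G_2$-structure. For each $c\in(0,\pi/2)$ let $f=f_c:[9/4,\infty)\to[0,\infty)$ be the non-negative continuous function with $f(9/4)=0$ defined implicitly by $$24\,\tan\!\big(f(r)/3+c\big)\,f(r)=16r^2-81$$ (the branch with $0\le f(r)/3+c<\pi/2$). Then $A_c=f_c(r)\,\eta_1^+$, $c\in(0,\pi/2)$, is a $1$-parameter family of (smooth) deformed $G_2$-instantons on $\mathbb{R}^4\times S^3$, i.e. $F=dA_c$ satisfies $\frac16 F^3-F\wedge *_\varphi\varphi=0$. Moreover, as $c\to\pi/2$ the connection $A_c$ converges to the flat connection $A=0$, in the sense that $f_c\to 0$ uniformly on $[9/4,\infty)$.
   Context: Conventions: the gauge group is $U(1)$, its Lie algebra is identified with $\mathbb{R}$, a connection on the trivial line bundle is a real $1$-form $A$, and its curvature is $F_A=dA$ (powers are wedge powers). Invariant forms: let $T_1,T_2,T_3$ be the basis of $\mathfrak{su}_2$ with $[T_i,T_j]=2\varepsilon_{ijk}T_k$. On $S^3\times S^3=SU(2)\times SU(2)$ use the left-invariant vector fields $T_i^+=(T_i,T_i)$, $T_i^-=(T_i,-T_i)$ and denote by $\eta_i^\pm$ the dual coframe, so that $d\eta_i^+=-\varepsilon_{ijk}(\eta_j^+\wedge\eta_k^++\eta_j^-\wedge\eta_k^-)$ and $d\eta_i^-=-2\varepsilon_{ijk}\,\eta_j^-\wedge\eta_k^+$ (repeated indices summed). Write $\eta^{\pm\pm}_{ij}=\eta_i^\pm\wedge\eta_j^\pm$,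 etc. (adjacent forms wedged). Given functions $A_1,A_2,B_1,B_2$ of $t$, set $\omega=4A_1B_1\,\eta_{11}^{-+}+4A_2B_2(\eta_{22}^{-+}+\eta_{33}^{-+})$, $\Omega^+=8B_1B_2^2\,\eta_{123}^{---}-8A_2^2B_1\,\eta_{123}^{-++}-8A_1A_2B_2(\eta_{123}^{++-}+\eta_{123}^{+-+})$, $\Omega^-=8A_1B_2^2\,\eta_{123}^{+--}-8A_2^2A_1\,\eta_{123}^{+++}+8B_1B_2A_2(\eta_{123}^{--+}+\eta_{123}^{-+-})$, and $\varphi=dt\wedge\omega+\Omega^+$, $*_\varphi\varphi=\frac12\omega\wedge\omega-dt\wedge\Omega^-$, with metric $g_\varphi=dt^2+(2A_1)^2(\eta_1^+)^2+(2A_2)^2((\eta_2^+)^2+(\eta_3^+)^2)+(2B_1)^2(\eta_1^-)^2+(2B_2)^2((\eta_2^-)^2+(\eta_3^-)^2)$. BGGG (Brandhuber–Gomis–Gubser–Gukov) $G_2$-structure: $r\in[9/4,\infty)$ with $t=\int_{9/4}^r\sqrt{\frac{(x-3/4)(x+3/4)}{(x-9/4)(x+9/4)}}\,dx$ and $A_1=\sqrt{\frac{(r-9/4)(r+9/4)}{(r-3/4)(r+3/4)}}$, $A_2=\sqrt{\frac{(r-9/4)(r+3/4)}{3}}$, $B_1=\frac{2r}{3}$, $B_2=\sqrt{\frac{(r+9/4)(r-3/4)}{3}}$. It is a torsion-free $G_2$-structure on $(9/4,\infty)\times S^3\times S^3$ which extends smoothly to $\mathbb{R}^4\times S^3$ by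 adding the zero section $S^3=SU(2)\times SU(2)/\Delta SU(2)$ at $r=9/4$; that is, $\mathbb{R}^4\times S^3\cong (SU(2)\times SU(2))\times_{\Delta SU(2)}\mathbb{C}^2$, where $\Delta SU(2)$ is the diagonal subgroup, and $(9/4,\infty)\times SU(2)\times SU(2)$ is the complement of the zero section. *)

(* Defs.v *)
From HB Require Import structures.
From mathcomp Require Export all_boot all_order all_fingroup all_algebra.
From mathcomp Require Export all_classical all_reals all_analysis.
From mathcomp Require Import ring.

Set Implicit Arguments.
Unset Strict Implicit.
Unset Printing Implicit Defensive.

Import Order.TTheory GRing.Theory Num.Theory.
Import numFieldNormedType.Exports.

Local Open Scope classical_set_scope.
Local Open Scope ring_scope.

(** * Differential forms on a finite-dimensional real vector space

    A k-form is given by its values [w p v] at the point [p] on the vectors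
    [v 0, ..., v (k-1)]; the wedge product is normalised so that
    (e_1 /\ ... /\ e_k)(v) = det (e_i (v_j)).  *)

Section Forms.
Context {R : realType}.

Definition form (V : normedModType R) (k : nat) := V -> ('I_k -> V) -> R.

(* C^oo: all iterated directional derivatives exist and are continuous
   (the usual notion when [V] is finite-dimensional). *)
Definition smooth (V : normedModType R) (g : V -> R) : Prop :=
  forall s : seq V,
    let h : V -> R := foldr (fun v h => 'D_v h) g s in
    continuous h /\ forall v p, derivable h p v.

Definition alternating_multilinear (V : normedModType R) k
    (w : ('I_k -> V) -> R) : Prop :=
  (forall (v : 'I_k -> V) (i : 'I_k) (a : R) (x y : V),
     w (dfwith v i (a *: x + y)) =
     a * w (dfwith v i x) + w (dfwith v i y)) /\
  (forall (v : 'I_k -> V) (i j : 'I_k), i != j -> v i = v j -> w v = 0).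

Definition smooth_form (V : normedModType R) k (w : form V k) : Prop :=
  (forall p, alternating_multilinear (w p)) /\
  (forall v, smooth (fun p => w p v)).

Definition wedge (V : normedModType R) k l (a : form V k) (b : form V l) :
    form V (k + l) := fun p v =>
  (k`!%:R * l`!%:R)^-1 *
  \sum_(s : 'S_(k + l)) (-1) ^+ s * a p (fun i => v (s (lshift l i)))
                                  * b p (fun j => v (s (rshift k j))).

Definition fadd (V : normedModType R) k (a b : form V k) : form V k :=
  fun p v => a p v + b p v.
Definition fsub (V : normedModType R) k (a b : form V k) : form V k :=
  fun p v => a p v - b p v.
Definition fmul (V : normedModType R) k (g : V -> R) (a : form V k) :
    form V k := fun p v => g p * a p v.

Definition form0 (V : normedModType R) (g : V -> R) : form V 0 :=
  fun p _ => g p.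

Definition extd (V : normedModType R) k (w : form V k) : form V k.+1 :=
  fun p v =>
  \sum_(i < k.+1)
    (-1) ^+ i * 'D_(v i) (fun q => w q (fun j => v (lift i j))) p.

Definition pullback (V W : normedModType R) k (G : V -> W) (w : form W k) :
    form V k := fun p v => w (G p) (fun i => 'd G p (v i)).

(** Equality of the restrictions of two forms to a submanifold [M] of [V]
    whose tangent space at [p] is [T p].  Every smooth form on a closed
    submanifold is the restriction of a smooth form on [V], and restriction
    commutes with the wedge product and the exterior derivative. *)
Definition eq_forms_on (V : normedModType R) (M : set V) (T : V -> set V) k
    (a b : form V k) : Prop :=
  forall p, M p -> forall v, (forall i, T p (v i)) -> a p v = b p v.

(** [psi] is the 4-form *phi; [A] is a connection on the trivial U(1)-bundle
    over [M]. *)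
Definition deformed_G2_instanton (V : normedModType R) (M : set V)
    (T : V -> set V) (psi : form V 4) (A : form V 1) : Prop :=
  let F : form V 2 := extd A in
  eq_forms_on M T
    (fsub (fmul (cst 6^-1) (wedge (wedge F F) F : form V 6)) (wedge F psi))
    (fun _ _ => 0).

End Forms.

Notation "a \wedge b" := (wedge a b) (at level 40, left associativity).
Notation "a \fadd b" := (fadd a b) (at level 50, left associativity).
Notation "a \fsub b" := (fsub a b) (at level 50, left associativity).
Notation "g \fmul a" := (fmul g a) (at level 45, right associativity).

(** * Quaternions

    x_0 + x_1 i + x_2 j + x_3 k.  SU(2) is the group of unit quaternions, with
    (T_1, T_2, T_3) = (i, j, k), so that [T_i, T_j] = 2 eps_ijk T_k; it acts
    on the quaternions (= C^2) by left multiplication. *)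

Section Quaternions.
Context {R : realType}.

Definition quat (a b c d : R) : 'rV[R]_4 := \row_(i < 4) [:: a; b; c; d]`_i.
Definition q0 (x : 'rV[R]_4) : R := x 0 (@Ordinal 4 0 isT).
Definition q1 (x : 'rV[R]_4) : R := x 0 (@Ordinal 4 1 isT).
Definition q2 (x : 'rV[R]_4) : R := x 0 (@Ordinal 4 2 isT).
Definition q3 (x : 'rV[R]_4) : R := x 0 (@Ordinal 4 3 isT).

Definition qmul (x y : 'rV[R]_4) : 'rV[R]_4 :=
  quat (q0 x * q0 y - q1 x * q1 y - q2 x * q2 y - q3 x * q3 y)
       (q0 x * q1 y + q1 x * q0 y + q2 x * q3 y - q3 x * q2 y)
       (q0 x * q2 y - q1 x * q3 y + q2 x * q0 y + q3 x * q1 y)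
       (q0 x * q3 y + q1 x * q2 y - q2 x * q1 y + q3 x * q0 y).
Definition qconj (x : 'rV[R]_4) : 'rV[R]_4 :=
  quat (q0 x) (- q1 x) (- q2 x) (- q3 x).
Definition qdot (x y : 'rV[R]_4) : R :=
  q0 x * q0 y + q1 x * q1 y + q2 x * q2 y + q3 x * q3 y.

(* T_1, T_2, T_3 are [qT] at the indices 0, 1, 2. *)
Definition qT (i : 'I_3) : 'rV[R]_4 := delta_mx 0 (lift ord0 i).

End Quaternions.

Section Complement.
Variable R : realType.

(* The points of (9/4, oo) x SU(2) x SU(2) are written (r, a, b). *)
Definition E1 : normedModType R := (R * 'rV[R]_4 * 'rV[R]_4)%type.

Definition M1 : set E1 := [set p | [/\ 9 / 4 < p.1.1,
  qdot p.1.2 p.1.2 = 1 & qdot p.2 p.2 = 1]].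
Definition T1 (p : E1) : set E1 := [set v |
  qdot p.1.2 v.1.2 = 0 /\ qdot p.2 v.2 = 0].

(* The left-invariant fields T_i^+ = (T_i, T_i) and T_i^- = (T_i, - T_i). *)
Definition Tp (i : 'I_3) (p : E1) : E1 :=
  (0, qmul p.1.2 (qT i), qmul p.2 (qT i)).
Definition Tm (i : 'I_3) (p : E1) : E1 :=
  (0, qmul p.1.2 (qT i), - qmul p.2 (qT i)).

(* Their dual coframe: half the sum and difference of the T_i-components of
   the Maurer-Cartan forms a^-1 da and b^-1 db. *)
Definition etap (i : 'I_3) : form E1 1 := fun p v =>
  2^-1 * (qmul (qconj p.1.2) (v 0).1.2 0 (lift ord0 i) +
          qmul (qconj p.2) (v 0).2 0 (lift ord0 i)).
Definition etam (i : 'I_3) : form E1 1 := fun p v =>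
  2^-1 * (qmul (qconj p.1.2) (v 0).1.2 0 (lift ord0 i) -
          qmul (qconj p.2) (v 0).2 0 (lift ord0 i)).

Lemma eta_dual (i j : 'I_3) (p : E1) : M1 p ->
  [/\ etap i p (fun=> Tp j p) = (i == j)%:R,
      etap i p (fun=> Tm j p) = 0,
      etam i p (fun=> Tm j p) = (i == j)%:R
    & etam i p (fun=> Tp j p) = 0].
Proof.
case=> _ ha hb.
have h (x : 'rV[R]_4) : qdot x x = 1 ->
    qmul (qconj x) (qmul x (qT j)) 0 (lift ord0 i) = (i == j)%:R.
  rewrite /qdot /qmul /qconj /quat /qT /q0 /q1 /q2 /q3 => <-.
  by case: j => [[|[|[|//]]] ?]; case: i => [[|[|[|//]]] ?];
     rewrite /= ?mxE /= ?mxE /= ?mxE /=; ring.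
have hN (x y : 'rV[R]_4) k : qmul x (- y) 0 k = - qmul x y 0 k.
  case: k => [[|[|[|[|//]]]] ?];
    rewrite /qmul /quat /q0 /q1 /q2 /q3 !mxE /=; ring.
rewrite /etap /etam /Tp /Tm /= !hN !h //.
by split; field.
Qed.

Definition ep1 : form E1 1 := etap (@Ordinal 3 0 isT).
Definition ep2 : form E1 1 := etap (@Ordinal 3 1 isT).
Definition ep3 : form E1 1 := etap (@Ordinal 3 2 isT).
Definition em1 : form E1 1 := etam (@Ordinal 3 0 isT).
Definition em2 : form E1 1 := etam (@Ordinal 3 1 isT).
Definition em3 : form E1 1 := etam (@Ordinal 3 2 isT).

Definition bggg_t (r : R) : R :=
  (\int[lebesgue_measure]_(x in `[9 / 4, r])
    Num.sqrt ((x - 3 / 4) * (x + 3 / 4) / ((x - 9 / 4) * (x + 9 / 4))))%R.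

Definition bggg_A1 (p : E1) : R := let r := p.1.1 in
  Num.sqrt ((r - 9 / 4) * (r + 9 / 4) / ((r - 3 / 4) * (r + 3 / 4))).
Definition bggg_A2 (p : E1) : R := let r := p.1.1 in
  Num.sqrt ((r - 9 / 4) * (r + 3 / 4) / 3).
Definition bggg_B1 (p : E1) : R := let r := p.1.1 in 2 * r / 3.
Definition bggg_B2 (p : E1) : R := let r := p.1.1 in
  Num.sqrt ((r + 9 / 4) * (r - 3 / 4) / 3).

Local Notation A1 := bggg_A1.
Local Notation A2 := bggg_A2.
Local Notation B1 := bggg_B1.
Local Notation B2 := bggg_B2.

Definition dt : form E1 1 := extd (form0 (fun p : E1 => bggg_t p.1.1)).

Definition bggg_omega : form E1 2 :=
  (4 \*o (A1 \* B1) \fmul em1 \wedge ep1)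
  \fadd (4 \*o (A2 \* B2) \fmul (em2 \wedge ep2 \fadd em3 \wedge ep3)).

Definition bggg_Omegap : form E1 3 :=
  (8 \*o (B1 \* B2 \* B2) \fmul em1 \wedge em2 \wedge em3)
  \fsub (8 \*o (A2 \* A2 \* B1) \fmul em1 \wedge ep2 \wedge ep3)
  \fsub (8 \*o (A1 \* A2 \* B2) \fmul
           (ep1 \wedge ep2 \wedge em3 \fadd ep1 \wedge em2 \wedge ep3)).

Definition bggg_Omegam : form E1 3 :=
  (8 \*o (A1 \* B2 \* B2) \fmul ep1 \wedge em2 \wedge em3)
  \fsub (8 \*o (A2 \* A2 \* A1) \fmul ep1 \wedge ep2 \wedge ep3)
  \fadd (8 \*o (B1 \* B2 \* A2) \fmul
           (em1 \wedge em2 \wedge ep3 \fadd em1 \wedge ep2 \wedge em3)).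

Definition bggg_phi : form E1 3 :=
  (dt \wedge bggg_omega : form E1 3) \fadd bggg_Omegap.
Definition bggg_psi : form E1 4 :=
  (cst 2^-1 \fmul bggg_omega \wedge bggg_omega)
  \fsub (dt \wedge bggg_Omegam : form E1 4).

(** * The total space R^4 x S^3

    The map [(a, b), v] |-> (a v, a b^-1) is a diffeomorphism from
    (SU(2) x SU(2)) x_{Delta SU(2)} C^2, where
    [(a g, b g), v] = [(a, b), g v], onto R^4 x S^3 (pairs (x, q) of
    quaternions with |q| = 1).  The zero section becomes x = 0, and the point
    (r, a, b) of the complement, at distance t(r) from the zero section, is
    [(a, b), t(r)]. *)

Definition E2 : normedModType R := ('rV[R]_4 * 'rV[R]_4)%type.

Definition M2 : set E2 := [set p | qdot p.2 p.2 = 1].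
Definition T2 (p : E2) : set E2 := [set v | qdot p.2 v.2 = 0].

Definition complement_map (p : E1) : E2 :=
  (bggg_t p.1.1 *: p.1.2, qmul p.1.2 (qconj p.2)).

(* The form [w] on R^4 x S^3 extends the form [a] on the complement. *)
Definition extends_form k (w : form E2 k) (a : form E1 k) : Prop :=
  eq_forms_on M1 T1 (pullback complement_map w) a.

(* [phi] and [psi] are the 3-form and the dual 4-form of the BGGG structure
   on R^4 x S^3. *)
Definition BGGG_structure (phi : form E2 3) (psi : form E2 4) : Prop :=
  [/\ smooth_form phi, smooth_form psi,
      extends_form phi bggg_phi & extends_form psi bggg_psi].

(* Only the values of [f] on [9/4, oo) matter. *)
Definition is_profile (c : R) (f : R -> R) : Prop :=
  [/\ {within `[9 / 4, +oo[, continuous f},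
      f (9 / 4) = 0,
      forall r, 9 / 4 <= r -> 0 <= f r,
      forall r, 9 / 4 <= r -> 0 <= f r / 3 + c < pi / 2
    & forall r, 9 / 4 <= r -> 24 * tan (f r / 3 + c) * f r = 16 * r ^+ 2 - 81].

Definition connection (f : R -> R) : form E1 1 :=
  (fun p : E1 => f p.1.1) \fmul ep1.

End Complement.

(* Main.v *)
Require Import Defs.
From mathcomp Require Import measurable_realfun ring lra.
Import Order.TTheory GRing.Theory Num.Theory.
Import numFieldNormedType.Exports.
Local Open Scope classical_set_scope.
Local Open Scope ring_scope.

(** On the complement M_1 of the zero section, the structure equations give
    dA = F = f' dr /\ eta_1^+ - 2 f (eta_23^++ + eta_23^--) for A = f(r) eta_1^+.
    Both F^3 and F /\ psi are then multiples of
    dr /\ eta_123^+++ /\ eta_23^--, so that the deformed instanton equation is one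
    scalar equation.  Since A_1 dt/dr = 1, B_2^2 - A_2^2 = r and
    (A_2 B_2)^2 = (r^2 - 81/16) (r^2 - 9/16) / 9, it reads
      f' (f^2 + (4/9) (r^2 - 81/16) (r^2 - 9/16)) = 4 r f,
    which is, up to a constant, f times the derivative of the implicit equation
    for f, once the tangent has been eliminated with that equation
    ([profile_function], [instanton_from_ode], [instanton_on_complement]).

    The profile exists because m = tan (f/3 + c) turns its equation into
    (arctan m - c) m = (2/9) (r^2 - 81/16), whose left-hand side is increasing
    from a point slightly below m = tan c on; so m, and with it f, is a smooth
    function of r on a neighbourhood of [9/4, oo).  It is unique because
    y tan (y/3 + c) is increasing in y >= 0.  Finally 0 <= f_c < 3 (pi/2 - c),
    which gives the uniform limit.

    For the extension over the zero section, A has to be a smooth form in the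
    coordinates (x, q) = (t a, a b^-1) of R^4 x S^3.  A computation with
    quaternions shows that t^2 eta_1^+ is the pull-back of a form alpha with
    polynomial coefficients, so one needs f = G (t^2) t^2 with G smooth on a
    neighbourhood of [0, oo) ([profile_radial]).  With w = r - 9/4 and u^2 = w, the
    arc length is t = u K(w), where K(w) is the integral over z in [0, 1] of a
    smooth function at w z^2.  Hence K is smooth ([smooth_on_moment]), t^2 = w K(w)^2
    is a smooth function of w with positive derivative, and w is a smooth
    function of t^2; as f vanishes to first order at w = 0, G exists.

    The equation for the extended form A = G (|x|^2) alpha then holds off the zero
    section, because the map (r, a, b) |-> (x, q) is onto {x <> 0}, also on tangent
    spaces, and pulls the curvature of A back to that of f eta_1^+
    ([complement_surj], [curvature_pushforward]).  It holds at x = 0 by continuity: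
    the tangent space of R^4 x S^3 at (x, q) does not depend on x. *)

Set Implicit Arguments.
Unset Strict Implicit.
Unset Printing Implicit Defensive.

(** * Exterior algebra of covectors *)

Section Exterior.
Context {R : realType}.

Definition block_perm_fun k l (s : 'S_k) (t : 'S_l) (i : 'I_(k + l)) : 'I_(k + l) :=
  match fintype.split i with inl j => lshift l (s j) | inr j => rshift k (t j) end.

Lemma block_perm_inj k l (s : 'S_k) (t : 'S_l) : injective (block_perm_fun s t).
Proof.
move=> i j; rewrite /block_perm_fun.
case: (fintype.splitP i) => i' Ei; case: (fintype.splitP j) => j' Ej E; apply: val_inj => /=.
- by rewrite Ei Ej; congr val; apply: (@perm_inj _ s); apply: lshift_inj E.
- by move/eqP: E; rewrite eq_lrshift.
- by move/eqP: E; rewrite eq_rlshift.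
- by rewrite Ei Ej (perm_inj (rshift_inj E)).
Qed.

Definition block_perm k l (s : 'S_k) (t : 'S_l) : 'S_(k + l) :=
  perm (@block_perm_inj k l s t).

Lemma block_perm_lshift k l (s : 'S_k) (t : 'S_l) i :
  block_perm s t (lshift l i) = lshift l (s i).
Proof.
rewrite permE /block_perm_fun; case: fintype.splitP => j E.
  by congr (lshift _ (s _)); apply: val_inj.
by have := ltn_ord i; rewrite -[X in (X < _)%N]/(nat_of_ord (lshift l i)) E ltnNge leq_addr.
Qed.

Lemma block_perm_rshift k l (s : 'S_k) (t : 'S_l) i :
  block_perm s t (rshift k i) = rshift k (t i).
Proof.
rewrite permE /block_perm_fun; case: fintype.splitP => j E.
  by have := ltn_ord j; rewrite -E /= ltnNge leq_addr.
by congr (rshift _ (t _)); apply: val_inj; apply/eqP; rewrite -(eqn_add2l k); apply/eqP.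
Qed.

(** The sign is the determinant of the permutation matrix, and that matrix is
    block diagonal. *)
Lemma sign_block_perm k l (s : 'S_k) (t : 'S_l) :
  (-1) ^+ block_perm s t = (-1) ^+ s * (-1) ^+ t :> R.
Proof.
rewrite -!det_perm -(det_ublock _ 0); congr determinant.
apply/matrixP => i j; rewrite -[i]fintype.splitK -[j]fintype.splitK.
case: (fintype.split i) => i'; case: (fintype.split j) => j' /=;
  rewrite (block_mxEul, block_mxEur, block_mxEdl, block_mxEdr) !mxE
    ?block_perm_lshift ?block_perm_rshift.
- by rewrite eq_lshift.
- by rewrite eq_lrshift.
- by rewrite eq_rlshift.
- by rewrite eq_rshift.
Qed.

(** Expanding both minors, each pair of permutations of the two blocks can be
    absorbed into the outer permutation and contributes one copy of the full
    determinant. *)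
Lemma sum_complementary_minors k l (M : 'M[R]_(k + l)) :
  \sum_(s : 'S_(k + l)) (-1) ^+ s *
     \det (\matrix_(i < k, j < k) M (lshift l i) (s (lshift l j))) *
     \det (\matrix_(i < l, j < l) M (rshift k i) (s (rshift k j))) =
  (k`!%:R * l`!%:R) * \det M.
Proof.
transitivity (\sum_(s : 'S_(k + l)) \sum_(a : 'S_k) \sum_(b : 'S_l)
    (-1) ^+ (block_perm a b * s)%g * \prod_i M i ((block_perm a b * s)%g i)).
  apply: eq_bigr => s _; rewrite /determinant -mulrA big_distrlr /= mulr_sumr.
  apply: eq_bigr => a _; rewrite mulr_sumr; apply: eq_bigr => b _.
  rewrite odd_permM signr_addb sign_block_perm big_split_ord /=.
  have -> : \prod_(i < k) M (lshift l i) ((block_perm a b * s)%g (lshift l i)) =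
      \prod_(i < k) (\matrix_(i, j) M (lshift l i) (s (lshift l j))) i (a i).
    by apply: eq_bigr => i _; rewrite mxE permM block_perm_lshift.
  have -> : \prod_(i < l) M (rshift k i) ((block_perm a b * s)%g (rshift k i)) =
      \prod_(i < l) (\matrix_(i, j) M (rshift k i) (s (rshift k j))) i (b i).
    by apply: eq_bigr => i _; rewrite mxE permM block_perm_rshift.
  move: (\prod_(i < k) _) (\prod_(i < l) _) => A B.
  by rewrite [RHS]mulrAC mulrACA mulrC mulrA.
rewrite exchange_big /=.
under eq_bigr do rewrite exchange_big /=.
have E (a : 'S_k) (b : 'S_l) : \sum_(s : 'S_(k + l)) (-1) ^+ (block_perm a b * s)%g *
     \prod_i M i ((block_perm a b * s)%g i) = \det M.
  by rewrite [RHS](reindex_inj (mulgI (block_perm a b))).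
under eq_bigr do under eq_bigr do rewrite E.
by rewrite !sumr_const !card_Sn -mulrnA -natrM mulr_natl mulnC.
Qed.

Variable V : normedModType R.

(** The wedge product of the covectors e_i, for i running through the list s.
    Lists of indices make repetitions and the order of the factors decidable by
    computation. *)
Definition monomial (e : nat -> V -> R) (s : seq nat) n (v : 'I_n -> V) : R :=
  \det (\matrix_(i < n, j < n) e (nth 0%N s i) (v j)).

Definition extpoly (e : nat -> V -> R) (L : seq (R * seq nat)) n
    (v : 'I_n -> V) : R :=
  \sum_(t <- L) t.1 * monomial e t.2 v.

(** This is the normalisation of the wedge product for which a product of
    covectors is a determinant. *)
Lemma wedge_monomial (e : nat -> V -> R) k l (s1 s2 : seq nat) (v : 'I_(k + l) -> V) :
  size s1 = k ->
  (k`!%:R * l`!%:R)^-1 *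
  \sum_(s : 'S_(k + l)) (-1) ^+ s * monomial e s1 (fun i => v (s (lshift l i)))
                                  * monomial e s2 (fun j => v (s (rshift k j)))
  = monomial e (s1 ++ s2) v.
Proof.
move=> sz.
pose M := \matrix_(i < k + l, j < k + l) e (nth 0%N (s1 ++ s2) i) (v j).
transitivity ((k`!%:R * l`!%:R)^-1 * ((k`!%:R * l`!%:R) * \det M)); last first.
  rewrite mulrA mulVf ?mul1r // -natrM pnatr_eq0 -lt0n muln_gt0 !fact_gt0 //.
rewrite -sum_complementary_minors; congr (_ * _); apply: eq_bigr => s _.
rewrite /monomial; congr (_ * _ * _); congr determinant;
  apply/matrixP => i j; rewrite !mxE nth_cat sz /=.
  by rewrite ltn_ord.
by rewrite ltnNge leq_addr /= addKn.
Qed.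

Lemma monomial_repeat (e : nat -> V -> R) s n (v : 'I_n -> V) :
  size s = n -> ~~ uniq s -> monomial e s v = 0.
Proof.
move=> sz /(uniqPn 0%N)[i [j [ij jn E]]]; rewrite sz in jn.
apply: (determinant_alternate (i1 := Ordinal (ltn_trans ij jn)) (i2 := Ordinal jn)).
  by rewrite -val_eqE /= (ltn_eqF ij).
by move=> x; rewrite !mxE /= E.
Qed.

Lemma monomial_swap (e : nat -> V -> R) (s1 s2 : seq nat) x y n (v : 'I_n -> V) :
  size (s1 ++ x :: y :: s2) = n ->
  monomial e (s1 ++ x :: y :: s2) v = - monomial e (s1 ++ y :: x :: s2) v.
Proof.
move=> sz.
have h1 : (size s1 < n)%N by rewrite -sz size_cat /= addnS ltnS leq_addr.
have h2 : ((size s1).+1 < n)%N by rewrite -sz size_cat /= !addnS !ltnS leq_addr.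
set i1 := Ordinal h1; set i2 := Ordinal h2.
rewrite /monomial -mulN1r.
have -> : -1 = (-1) ^+ tperm i1 i2 :> R.
  by rewrite odd_tperm -val_eqE /= ltn_eqF // expr1.
rewrite -det_perm -det_mulmx -row_permE; congr determinant.
apply/matrixP => i j; rewrite !mxE !nth_cat.
case: tpermP => [->|->|/eqP n1 /eqP n2] /=.
- by rewrite ltnn subnn ltnNge leqnSn /= subSnn.
- by rewrite ltnn subnn ltnNge leqnSn /= subSnn.
case: ltnP => // hi; congr (e _ _).
have : (i - size s1 != 0)%N by apply: contra n1; rewrite -val_eqE /= subn_eq0 eqn_leq hi andbT.
have : (i - size s1 != 1)%N.
  by apply: contra n2; rewrite -val_eqE /= => /eqP E; rewrite -(subnK hi) E add1n.
by case: (i - size s1)%N => [|[|]].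
Qed.

(** Insertion sort which also returns the parity of the number of exchanges. *)
Fixpoint insert_signed (x : nat) (s : seq nat) : bool * seq nat :=
  if s is y :: s' then
    if (y < x)%N then (~~ (insert_signed x s').1, y :: (insert_signed x s').2)
    else (false, x :: s)
  else (false, [:: x]).

Fixpoint sort_signed (s : seq nat) : bool * seq nat :=
  if s is x :: s' then
    ((sort_signed s').1 (+) (insert_signed x (sort_signed s').2).1,
     (insert_signed x (sort_signed s').2).2)
  else (false, [::]).

Lemma size_insert_signed x s : size (insert_signed x s).2 = (size s).+1.
Proof. by elim: s => //= y s IH; case: ifP => //= _; rewrite IH. Qed.

Lemma size_sort_signed s : size (sort_signed s).2 = size s.
Proof. by elim: s => //= y s IH; rewrite size_insert_signed IH. Qed.

Lemma monomial_insert (e : nat -> V -> R) (s1 s : seq nat) x n (v : 'I_n -> V) :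
  size (s1 ++ x :: s) = n ->
  monomial e (s1 ++ x :: s) v =
  (-1) ^+ (insert_signed x s).1 * monomial e (s1 ++ (insert_signed x s).2) v.
Proof.
elim: s s1 => [|y s IH] s1 sz /=; first by rewrite mul1r.
case: ifP => _ /=; last by rewrite mul1r.
rewrite monomial_swap // -cat_rcons IH; last by rewrite -sz !size_cat size_rcons /= !addnS.
by rewrite cat_rcons signrN mulNr.
Qed.

Lemma monomial_sort (e : nat -> V -> R) (s1 s : seq nat) n (v : 'I_n -> V) :
  size (s1 ++ s) = n ->
  monomial e (s1 ++ s) v =
  (-1) ^+ (sort_signed s).1 * monomial e (s1 ++ (sort_signed s).2) v.
Proof.
elim: s s1 => [|x s IH] s1 sz /=; first by rewrite mul1r.
rewrite -cat_rcons IH; last by rewrite cat_rcons.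
rewrite cat_rcons monomial_insert; last by rewrite -sz !size_cat /= size_sort_signed.
by rewrite mulrA signr_addb.
Qed.

(** Monomials with a repeated factor are dropped and the others sorted, so that
    in a product of explicit forms only a few distinct monomials remain. *)
Definition normal_terms (L : seq (R * seq nat)) : seq (R * seq nat) :=
  [seq ((if (sort_signed t.2).1 then - t.1 else t.1), (sort_signed t.2).2)
     | t <- L & uniq t.2].

Lemma extpoly_normal (e : nat -> V -> R) L n (v : 'I_n -> V) :
  all (fun t => size t.2 == n) L ->
  extpoly e L v = extpoly e (normal_terms L) v.
Proof.
rewrite /extpoly; elim: L => [|t L IH] /=; first by rewrite !big_nil.
case/andP=> /eqP sz /IH {}IH; rewrite big_cons IH /normal_terms /=.
case: ifP => [_|/negbT nu]; last by rewrite (monomial_repeat _ _ sz nu) mulr0 add0r.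
rewrite /= big_cons /=; congr (_ + _).
rewrite -[X in monomial e X](cat0s t.2) monomial_sort //= mulrA.
by case: (sort_signed t.2).1; rewrite ?mulrN1 ?mulr1.
Qed.

Section Calculus.
Variables (e : nat -> V -> R) (T : set V) (p : V).

(** The equality is asked on T only, since the structure equations for the
    exterior derivatives of the coframe hold on tangent vectors only. *)
Definition is_extpoly k (a : form V k) (L : seq (R * seq nat)) : Prop :=
  forall v, (forall i, T (v i)) -> a p v = extpoly e L v.

Definition scale_terms (c : R) (L : seq (R * seq nat)) : seq (R * seq nat) :=
  [seq (c * t.1, t.2) | t <- L].

Lemma extpoly_scale c L n (v : 'I_n -> V) :
  extpoly e (scale_terms c L) v = c * extpoly e L v.
Proof. by rewrite /extpoly big_map mulr_sumr; apply: eq_bigr => t _; rewrite mulrA. Qed.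

Lemma is_extpoly1 (a : form V 1) i :
  (forall v, a p v = e i (v 0)) -> is_extpoly a [:: (1, [:: i])].
Proof.
move=> E v _; rewrite /extpoly big_seq1 mul1r /monomial E.
by rewrite [X in \det X]mx11_scalar det_scalar1 !mxE.
Qed.

Lemma is_extpolyD k (a b : form V k) L1 L2 :
  is_extpoly a L1 -> is_extpoly b L2 -> is_extpoly (a \fadd b) (L1 ++ L2).
Proof. by move=> Ea Eb v Tv; rewrite /fadd Ea // Eb // /extpoly big_cat. Qed.

Lemma is_extpolyB k (a b : form V k) L1 L2 :
  is_extpoly a L1 -> is_extpoly b L2 ->
  is_extpoly (a \fsub b) (L1 ++ scale_terms (- 1) L2).
Proof.
move=> Ea Eb v Tv; rewrite /fsub Ea // Eb // /extpoly big_cat /=.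
by rewrite -![\big[_/_]_(_ <- _) _]/(extpoly _ _ _) extpoly_scale mulN1r.
Qed.

Lemma is_extpolyM k g (a : form V k) L :
  is_extpoly a L -> is_extpoly (g \fmul a) (scale_terms (g p) L).
Proof. by move=> Ea v Tv; rewrite /fmul Ea // extpoly_scale. Qed.

Lemma is_extpoly_wedge k l (a : form V k) (b : form V l) L1 L2 :
  is_extpoly a L1 -> is_extpoly b L2 -> all (fun t => size t.2 == k) L1 ->
  is_extpoly (a \wedge b) [seq (t.1 * u.1, t.2 ++ u.2) | t <- L1, u <- L2].
Proof.
move=> Ea Eb sz v Tv; rewrite /wedge /extpoly big_allpairs_dep /=.
transitivity ((k`!%:R * l`!%:R)^-1 * \sum_(s : 'S_(k + l)) \sum_(t <- L1) \sum_(u <- L2)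
    t.1 * u.1 * ((-1) ^+ s * monomial e t.2 (fun i => v (s (lshift l i)))
                           * monomial e u.2 (fun j => v (s (rshift k j))))).
  congr (_ * _); apply: eq_bigr => s _.
  rewrite Ea // Eb // -mulrA /extpoly big_distrlr /= mulr_sumr; apply: eq_bigr => t _.
  rewrite mulr_sumr; apply: eq_bigr => u _.
  by rewrite [X in _ * X = _]mulrACA [LHS]mulrCA (mulrA ((-1) ^+ s)).
rewrite exchange_big /= mulr_sumr big_seq [RHS]big_seq; apply: eq_bigr => t tL1.
rewrite exchange_big /= mulr_sumr; apply: eq_bigr => u _.
have /eqP szt := allP sz _ tL1.
by rewrite -(wedge_monomial _ _ _ szt) mulrCA -mulr_sumr.
Qed.

End Calculus.
End Exterior.


(** * Derivatives and smooth functions of one variable *)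

Lemma derive_ident (R : realType) (x : R) : is_derive x 1 (fun y : R => y) 1.
Proof. exact: is_derive_id. Qed.

Section Derivatives.
Context {R : realType} {V : normedModType R}.
Implicit Types (g h : V -> R) (p v : V).

Lemma derive_eq p v g (a b : R) : is_derive p v g a -> a = b -> is_derive p v g b.
Proof. by move=> ? <-. Qed.

Lemma derive_add p v g h (a b : R) : is_derive p v g a -> is_derive p v h b ->
  is_derive p v (fun q => g q + h q) (a + b).
Proof. exact: is_deriveD. Qed.

Lemma derive_sub p v g h (a b : R) : is_derive p v g a -> is_derive p v h b ->
  is_derive p v (fun q => g q - h q) (a - b).
Proof. exact: is_deriveB. Qed.

Lemma derive_mul p v g h (a b : R) : is_derive p v g a -> is_derive p v h b ->
  is_derive p v (fun q => g q * h q) (a * h p + g p * b).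
Proof.
move=> dg dh; apply: (derive_eq (is_deriveM dg dh)).
by rewrite addrC; congr (_ + _); rewrite [LHS]mulrC.
Qed.

Lemma derive_const p v (c : R) : is_derive p v (fun=> c) 0.
Proof. exact: is_derive_cst. Qed.

Lemma derive_scale p v g (a c : R) : is_derive p v g a ->
  is_derive p v (fun q => c * g q) (c * a).
Proof.
move=> dg; apply: (derive_eq (derive_mul (derive_const p v c) dg)).
by rewrite mul0r add0r.
Qed.

Lemma derive_line g p v (d : R) : is_derive p v g d <->
  is_derive (0 : R) 1 (fun t : R => g (t *: v + p)) d.
Proof.
have E : 'D_v g p = 'D_1 (fun t : R => g (t *: v + p)) 0.
  rewrite /derive; set k1 := fun t => t^-1 *: _; set k2 := fun t => t^-1 *: _.
  suff -> : k1 = k2 by [].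
  by apply/funext => t; rewrite /k1 /k2 /= addr0 scale0r add0r [_%:A]mulr1.
have [to_line of_line] := derivable1P g p v.
split=> -[dg Dg]; split; [exact: to_line|by rewrite -E|exact: of_line|by rewrite E].
Qed.

(** Restricting to the line through p in the direction v turns the chain rule
    for a directional derivative, which asks nothing of g beyond that
    direction, into the one for functions of one variable. *)
Lemma derive_comp p v (k : R -> R) g (a b : R) :
  is_derive p v g b -> is_derive (g p) 1 k a ->
  is_derive p v (fun q => k (g q)) (a * b).
Proof.
move=> /derive_line dg dk; apply/derive_line.
apply: (is_derive1_comp (f := k)) dg.
by rewrite scale0r add0r.
Qed.

End Derivatives.

Section CubicDerivatives.
Context {R : realType} {V : normedModType R}.
Implicit Types (g : V -> R) (p v : V).

(** Apart from functions of r or of |x|, the coefficients of the forms below are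
    polynomials of degree at most 3 in the point, hence cubics along every
    line. *)
Lemma derive_cubic g p v (b c d : R) :
  (forall h : R, g (h *: v + p) = g p + h * b + h * (h * c) + h * (h * (h * d))) ->
  is_derive p v g b.
Proof.
move=> E; apply/derive_line.
rewrite (_ : (fun h => _) = fun h : R => g p + h * b + h * (h * c) + h * (h * (h * d)));
  last exact/funext.
have i := derive_ident (0 : R).
have k (e : R) := derive_const (0 : R) 1 e.
apply: (derive_eq (derive_add (derive_add (derive_add (k (g p)) (derive_mul i (k b)))
  (derive_mul i (derive_mul i (k c)))) (derive_mul i (derive_mul i (derive_mul i (k d)))))).
ring.
Qed.

Lemma derive_affine g p v (b : R) :
  (forall h : R, g (h *: v + p) = g p + h * b) -> is_derive p v g b.
Proof. by move=> E; apply: (@derive_cubic g p v b 0 0) => h; rewrite E; ring. Qed.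

End CubicDerivatives.


Section DerivableFamilies.
Context {R : realType}.
Implicit Types (U : set R) (F : (R -> R) -> Prop) (f g h : R -> R).

(** A function is smooth when it belongs to a family of functions stable under
    differentiation.  This impredicative form of the coinductive definition
    spares all bookkeeping with n-th derivatives: to prove smoothness it is
    enough to exhibit a family. *)
Definition smooth_on U g : Prop :=
  exists2 F : (R -> R) -> Prop, F g &
    forall h, F h -> exists2 h', F h' & forall x, U x -> is_derive x 1 h (h' x).

Inductive algebra F : (R -> R) -> Prop :=
| algebra_in h : F h -> algebra F h
| algebra_cst c : algebra F (cst c)
| algebra_add g h : algebra F g -> algebra F h -> algebra F (fun x => g x + h x)
| algebra_mul g h : algebra F g -> algebra F h -> algebra F (fun x => g x * h x).

Lemma algebra_derive U F g :
  (forall h, F h -> exists2 h', algebra F h' & forall x, U x -> is_derive x 1 h (h' x)) ->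
  algebra F g -> exists2 g', algebra F g' & forall x, U x -> is_derive x 1 g (g' x).
Proof.
move=> dF; elim=> {g} [h /dF //|c|g h Fg [g' Fg' dg] Fh [h' Fh' dh]|
                        g h Fg [g' Fg' dg] Fh [h' Fh' dh]].
- by exists (cst 0); [exact: algebra_cst|move=> x _; exact: is_derive_cst].
- exists (fun x => g' x + h' x); first exact: algebra_add.
  by move=> x Ux; apply: is_deriveD; [exact: dg|exact: dh].
- exists (fun x => g' x * h x + g x * h' x).
    by apply: algebra_add; apply: algebra_mul.
  by move=> x Ux; apply: derive_mul; [exact: dg|exact: dh].
Qed.

(** By the Leibniz rule, it is enough that the derivatives of the generators lie
    in the algebra which they generate. *)
Lemma smooth_on_algebra U F g :
  (forall h, F h -> exists2 h', algebra F h' & forall x, U x -> is_derive x 1 h (h' x)) ->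
  algebra F g -> smooth_on U g.
Proof. by move=> dF Fg; exists (algebra F) => // h; exact: algebra_derive. Qed.

Lemma smooth_on_derive U g : smooth_on U g ->
  exists2 g', smooth_on U g' & forall x, U x -> is_derive x 1 g (g' x).
Proof. by case=> F Fg dF; have [g' Fg' dg] := dF _ Fg; exists g' => //; exists F. Qed.

Lemma smooth_on_continuous U g x : smooth_on U g -> U x -> {for x, continuous g}.
Proof.
move=> /smooth_on_derive[g' _ dg] Ux.
by apply/differentiable_continuous/derivable1_diffP; case: (dg x Ux).
Qed.

Lemma smooth_on_sub U U' g : U' `<=` U -> smooth_on U g -> smooth_on U' g.
Proof.
move=> s [F Fg dF]; exists F => // h /dF[h' Fh' dh]; exists h' => // x /s; exact: dh.
Qed.

Lemma smooth_on_cst U c : smooth_on U (cst c).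
Proof. by apply: (@smooth_on_algebra _ (fun _ => False)) => //; exact: algebra_cst. Qed.

Lemma smooth_on_id U : smooth_on U id.
Proof.
apply: (@smooth_on_algebra _ (fun h => h = id)); last exact: algebra_in.
by move=> _ ->; exists (cst 1); [exact: algebra_cst|move=> x _; exact: is_derive_id].
Qed.

Lemma smooth_on_common_family U g h : smooth_on U g -> smooth_on U h ->
  exists2 F : (R -> R) -> Prop, F g /\ F h &
    forall h, F h -> exists2 h', algebra F h' & forall x, U x -> is_derive x 1 h (h' x).
Proof.
move=> [G Gg dG] [H Hh dH]; exists (fun k => G k \/ H k); first by split; [left|right].
move=> k [/dG|/dH][k' Fk' dk]; exists k' => //; apply: algebra_in; by [left|right].
Qed.

Lemma smooth_on_add U g h :
  smooth_on U g -> smooth_on U h -> smooth_on U (fun x => g x + h x).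
Proof.
move=> sg sh; have [F [Fg Fh] dF] := smooth_on_common_family sg sh.
by apply: (smooth_on_algebra dF); apply: algebra_add; exact: algebra_in.
Qed.

Lemma smooth_on_mul U g h :
  smooth_on U g -> smooth_on U h -> smooth_on U (fun x => g x * h x).
Proof.
move=> sg sh; have [F [Fg Fh] dF] := smooth_on_common_family sg sh.
by apply: (smooth_on_algebra dF); apply: algebra_mul; exact: algebra_in.
Qed.

Lemma smooth_on_comp U U' g h : (forall x, U x -> U' (h x)) ->
  smooth_on U' g -> smooth_on U h -> smooth_on U (fun x => g (h x)).
Proof.
move=> hU [G Gg dG] [H Hh dH].
apply: (@smooth_on_algebra _ (fun k => H k \/ exists2 k', G k' & k = k' \o h)); last first.
  by apply: algebra_in; right; exists g.
move=> k [/dH[k' Hk' dk]|[k0 /dG[k' Gk' dk] ->]].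
  by exists k' => //; apply: algebra_in; left.
have [h' Hh' dh] := dH _ Hh.
exists (fun x => k' (h x) * h' x).
  by apply: algebra_mul; apply: algebra_in; [right; exists k'|left].
by move=> x Ux; apply: is_derive1_comp; [exact/dk/hU|exact: dh].
Qed.

Lemma smooth_on_inv : smooth_on [set x | x != 0] (fun x : R => x^-1).
Proof.
apply: (@smooth_on_algebra _ (fun h => h = (fun x => x^-1))); last exact: algebra_in.
move=> _ ->; exists (fun x => cst (-1) x * (x^-1 * x^-1)).
  by do ![apply: algebra_mul|exact: algebra_in|exact: algebra_cst].
move=> x /= x0; apply: is_derive_eq; first exact: (@is_deriveV _ id).
by rewrite /= [_ *: _]mulr1 mulN1r expr2 invfM.
Qed.

Let sc (a b : R) : a *: b = a * b. Proof. by []. Qed.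

Lemma smooth_on_sqrt : smooth_on [set x | 0 < x] (@Num.sqrt R).
Proof.
pose s (x : R) := (Num.sqrt x)^-1.
have ds (x : R) : 0 < x -> is_derive x 1 Num.sqrt (cst 2^-1 x * s x).
  by move=> x0; apply: is_derive_eq; [exact: is_derive1_sqrt|rewrite invfM].
apply: (@smooth_on_algebra _ (fun h => h = Num.sqrt \/ h = s)); last first.
  by apply: algebra_in; left.
move=> _ [->|->].
  exists (fun x => cst 2^-1 x * s x) => //.
  by apply: algebra_mul; [exact: algebra_cst|apply: algebra_in; right].
exists (fun x => cst (- 2^-1) x * (s x * (s x * s x))).
  by do 3?[apply: algebra_mul; first by [exact: algebra_cst|apply: algebra_in; right]];
    apply: algebra_in; right.
move=> x /= x0; apply: is_derive_eq.
  by apply: (is_deriveV _ (ds x x0)); rewrite gt_eqF // sqrtr_gt0.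
rewrite /s /cst /= ?sc -?exprVn. ring.
Qed.

Lemma smooth_on_atan U : smooth_on U (@atan R).
Proof.
pose s (x : R) := (1 + x ^+ 2)^-1.
have nz (x : R) : 1 + x ^+ 2 != 0 by rewrite gt_eqF // ltr_pwDl // sqr_ge0.
apply: (@smooth_on_sub setT) => //.
apply: (@smooth_on_algebra _ (fun h => [\/ h = atan, h = s | h = id])); last first.
  exact/algebra_in/Or31.
move=> _ [->|->|->].
- by exists s; [exact/algebra_in/Or32|move=> x _; exact: is_derive1_atan].
- exists (fun x => cst (- 2) x * (x * (s x * s x))).
    apply: algebra_mul; first exact: algebra_cst.
    apply: algebra_mul; first exact/algebra_in/Or33.
    by apply: algebra_mul; exact/algebra_in/Or32.
  move=> x _; apply: is_derive_eq; first by apply: is_deriveV.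
rewrite /s /cst /= ?sc -exprVn add0r ?expr1 ?mulr1. ring.
- by exists (cst 1); [exact: algebra_cst|move=> x _; exact: is_derive_id].
Qed.

(** g' = (1 / h') o g, so the functions k o g, for k in a family containing 1 / h',
    form with g a family that is stable under differentiation. *)
Lemma smooth_on_inverse U U' h h' g :
  smooth_on U h' -> (forall x, U x -> is_derive x 1 h (h' x)) ->
  (forall x, U x -> h' x != 0) -> open U' ->
  (forall y, U' y -> U (g y) /\ h (g y) = y) ->
  (forall y, U' y -> \forall x \near g y, g (h x) = x) -> open U ->
  smooth_on U' g.
Proof.
move=> sh' dh h'0 oU' gU gh oU.
have [G Gg dG] : smooth_on U (fun x => (h' x)^-1).
  by apply: (@smooth_on_comp _ [set x | x != 0]) => //; exact: smooth_on_inv.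
have dg y : U' y -> is_derive y 1 g (h' (g y))^-1.
  move=> U'y; have [Ug hg] := gU y U'y.
  rewrite -{1}hg; apply: is_derive_inverse.
  - exact: gh.
  - near=> x; apply/differentiable_continuous/derivable1_diffP.
    suff /dh[] : U x by [].
    by near: x; apply: open_nbhs_nbhs.
  - exact: dh.
  - exact: h'0.
apply: (@smooth_on_algebra _ (fun k => k = g \/ exists2 k', G k' & k = k' \o g)); last first.
  by apply: algebra_in; left.
move=> _ [->|[k /dG[k' Gk' dk] ->]].
  exists (fun x => (h' (g x))^-1) => //; apply: algebra_in; right.
  by exists (fun x => (h' x)^-1).
exists (fun x => k' (g x) * (h' (g x))^-1).
  by apply: algebra_mul; apply: algebra_in; right; [exists k'|exists (fun x => (h' x)^-1)].
move=> y U'y; apply: is_derive1_comp; last exact: dg.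
by apply: dk; case: (gU y U'y).
Unshelve. all: by end_near. Qed.

Definition above (a : R) : set R := [set x | a < x].

End DerivableFamilies.

(** * Smooth dependence of an integral on a parameter *)

Section Moments.
Context {R : realType}.
Local Notation mu := (@lebesgue_measure R).
Implicit Types h : R -> R.

(** Differentiation under the integral sign maps moment n h to
    moment (n + 2) h', so these functions form a family stable under
    differentiation. *)
Definition moment (n : nat) (h : R -> R) (w : R) : R :=
  (\int[mu]_(z in `[0%R, 1%R]) (z ^+ n * h (w * z ^+ 2)))%R.

Lemma cont_add (f g : R -> R) (z : R) : {for z, continuous f} ->
  {for z, continuous g} -> {for z, continuous (fun y => f y + g y)}.
Proof. by move=> cf cg; apply: cvgD. Qed.

Lemma cont_mul (f g : R -> R) (z : R) : {for z, continuous f} ->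
  {for z, continuous g} -> {for z, continuous (fun y => f y * g y)}.
Proof. by move=> cf cg; apply: cvgM. Qed.

Lemma cont_comp (f g : R -> R) (z : R) : {for z, continuous f} ->
  {for f z, continuous g} -> {for z, continuous (fun y => g (f y))}.
Proof. by move=> cf cg; apply: continuous_comp. Qed.

Lemma within_cont (f : R -> R) (i : interval R) :
  (forall z : R, z \in i -> {for z, continuous f}) -> {within [set` i], continuous f}.
Proof. by move=> cf; apply: continuous_in_subspaceT => z; rewrite inE => /cf. Qed.

Lemma ray_square (a w z : R) : a < 0 -> a < w -> z \in `[0, 1] -> a < w * z ^+ 2.
Proof.
move=> a0 aw; rewrite in_itv /= => /andP[z0 z1].
have /andP[s0 s1] : 0 <= z ^+ 2 <= 1 by rewrite sqr_ge0 expr_le1.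
have [w0|w0] := ltP w 0; nra.
Qed.

Lemma moment_integrand_derive (h : R -> R) (d w z : R) n :
  is_derive (w * z ^+ 2) 1 h d ->
  is_derive w 1 (fun y => z ^+ n * h (y * z ^+ 2)) (z ^+ n.+2 * d).
Proof.
move=> dh.
have dl : is_derive w 1 (fun y => y * z ^+ 2) (z ^+ 2).
  apply: (derive_eq (derive_mul (derive_ident w) (derive_const _ _ (z ^+ 2)))).
  by rewrite mulr0 addr0 mul1r.
apply: (derive_eq (derive_scale (z ^+ n) (derive_comp dl dh))).
rewrite !exprS; ring.
Qed.

Lemma continuous_moment_integrand n (a w z : R) h : a < 0 -> a < w ->
  (forall x, a < x -> {for x, continuous h}) -> z \in `[0, 1] ->
  {for z, continuous (fun y : R => y ^+ n * h (w * y ^+ 2))}.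
Proof.
move=> a0 aw ch z01; apply: cont_mul; first exact: exprn_continuous.
apply: (@cont_comp (fun z => w * z ^+ 2) h); last by apply: ch; apply: ray_square.
by apply: cont_mul; [exact: cst_continuous|exact: exprn_continuous].
Qed.

Lemma integrable_moment n (a w : R) h : a < 0 -> a < w ->
  (forall x, a < x -> {for x, continuous h}) ->
  mu.-integrable `[0, 1] (EFin \o (fun z => z ^+ n * h (w * z ^+ 2))).
Proof.
move=> a0 aw ch; apply: continuous_compact_integrable; first exact: segment_compact.
by apply: within_cont => z; exact: (continuous_moment_integrand (n := n) a0 aw ch).
Qed.

Lemma moment_derive (a x : R) (h h' : R -> R) n : a < 0 -> a < x ->
  (forall y, a < y -> is_derive y 1 h (h' y)) ->
  (forall y, a < y -> {for y, continuous h'}) ->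
  is_derive x 1 (moment n h) (moment n.+2 h' x).
Proof.
move=> a0 ax dh ch'.
have ch y : a < y -> {for y, continuous h}.
  by move=> /dh[+ _] => /derivable1_diffP; exact: differentiable_continuous.
(* h' is bounded on a segment [u, v] that contains 0 and has x in its interior,
   hence contains w z^2 for all w in it and all z in [0, 1] *)
pose u := (a + Num.min x 0) / 2; pose v := Num.max x 0 + 1.
have m : a < Num.min x 0 by rewrite lt_min ax a0.
have [au um] : a < u /\ u < Num.min x 0 by rewrite /u; split; lra.
have [um1 um2] : u < x /\ u < 0 by move: um; rewrite lt_min => /andP[].
have mv : Num.max x 0 < v by rewrite /v ltrDl.
have [vm1 vm2] : x < v /\ 0 < v by move: mv; rewrite gt_max => /andP[].
have uv : u <= v by rewrite ltW // (lt_trans um2).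
have cn : {within `[u, v], continuous (fun y => `|h' y|)}.
  apply: within_cont => y; rewrite in_itv /= => /andP[uy _].
  apply: (cont_comp (g := Num.norm)); [exact/ch'/(lt_le_trans au)|exact: norm_continuous].
have [c _ hc] := EVT_max uv cn.
pose f (w z : R) : R := z ^+ n * h (w * z ^+ 2).
have df (w z : R) : a < w -> z \in `[0, 1] ->
    is_derive w 1 (f ^~ z) (z ^+ n.+2 * h' (w * z ^+ 2)).
  by move=> aw z01; apply/moment_integrand_derive/dh/ray_square.
have uE w : `]u, v[%classic w -> u < w /\ w < v.
  by rewrite /= in_itv /= => /andP[].
have intf w : `]u, v[%classic w -> mu.-integrable `[0, 1] (EFin \o f w).
  by move=> /uE[uw _]; apply: (@integrable_moment n a) => //; exact: lt_trans uw.
have derf (w z : R) : `]u, v[%classic w -> `[0, 1]%classic z -> derivable (f ^~ z) w 1.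
  by move=> /uE[uw _] z01; case: (df w z (lt_trans au uw) z01).
have dE (w z : R) : a < w -> z \in `[0, 1] -> partial1of2 f w z = z ^+ n.+2 * h' (w * z ^+ 2).
  by move=> aw z01; rewrite partial1of2E; have [_ ->] := df w z aw z01.
have intG : mu.-integrable `[0, 1] (EFin \o (cst `|h' c|)).
  apply: continuous_compact_integrable; first exact: segment_compact.
  by apply: continuous_subspaceT => ?; exact: cst_continuous.
have ub (w z : R) : `]u, v[%classic w -> `[0, 1]%classic z -> `|partial1of2 f w z| <= cst `|h' c| z.
  move=> /uE[uw wv] z01; rewrite dE //; last exact: lt_trans uw.
  rewrite normrM -[leRHS]mul1r.
  move: (z01); rewrite /= in_itv /= => /andP[z0 z1].
  rewrite ler_pM // ?normr_ge0 //; first by rewrite ger0_norm ?exprn_ge0 // exprn_ile1.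
  apply: hc; rewrite in_itv /=.
  have /andP[s0 s1] : 0 <= z ^+ 2 <= 1 by rewrite sqr_ge0 expr_le1.
  by have [w0|w0] := ltP w 0; apply/andP; split; nra.
have ux : `]u, v[%classic x by rewrite /= in_itv /= um1.
have m01 : measurable (`[0, 1] : set R) by exact: measurable_itv.
have G0 (y : R) : 0 <= cst (T := R) `|h' c| y :> R by exact: normr_ge0.
have dI := @derivable_under_integral R _ _ mu f _ m01 _ _ _ ux intf derf _ G0 intG ub.
have eI := @differentiation_under_integral R _ _ mu f _ m01 _ _ _ ux intf derf _ G0 intG ub.
split; first exact: dI.
rewrite -derive1E /moment eI; apply: eq_Rintegral => z; rewrite inE => z01.
by rewrite dE.
Qed.

Lemma smooth_on_moment (a : R) h n : a < 0 ->
  smooth_on (above a) h -> smooth_on (above a) (moment n h).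
Proof.
move=> a0 [F Fh dF].
exists (fun g => exists2 k, F k & exists n, g = moment n k); first by exists h => //; exists n.
move=> _ [k /dF[k' Fk' dk] [m ->]].
exists (moment m.+2 k'); first by exists k' => //; exists m.+2.
move=> x ax; apply: (moment_derive _ a0 ax dk) => y ay.
have [k'' _ dk'] := dF _ Fk'.
by apply/differentiable_continuous/derivable1_diffP; case: (dk' y ay).
Qed.

(** The derivative of z h(x z^2) with respect to z is
    h(x z^2) + 2 x z^2 h'(x z^2); integrate it over [0, 1]. *)
Lemma moment_euler (a x : R) (h h' : R -> R) : a < 0 -> a < x ->
  (forall y, a < y -> is_derive y 1 h (h' y)) ->
  (forall y, a < y -> {for y, continuous h'}) ->
  moment 0 h x + 2 * x * moment 2 h' x = h x.
Proof.
move=> a0 ax dh ch'.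
have ch y : a < y -> {for y, continuous h}.
  by move=> /dh[+ _] => /derivable1_diffP; exact: differentiable_continuous.
have i0 := integrable_moment 0 a0 ax ch.
have i2 := integrable_moment 2 a0 ax ch'.
have m01 : measurable (`[0, 1] : set R) by exact: measurable_itv.
rewrite /moment -RintegralZl // -RintegralD //; last first.
  apply: continuous_compact_integrable; first exact: segment_compact.
  apply: within_cont => z z01; apply: cont_mul; first exact: cst_continuous.
  exact: (continuous_moment_integrand (n := 2) a0 ax ch').
pose F z := z * h (x * z ^+ 2).
have dF (z : R) : z \in `[0, 1] -> is_derive z 1 F
    (z ^+ 0 * h (x * z ^+ 2) + 2 * x * (z ^+ 2 * h' (x * z ^+ 2))).
  move=> z01.
  have dl : is_derive z 1 (fun y => x * y ^+ 2) (x * (2 * z)).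
    apply: derive_scale; apply: (derive_eq (derive_mul (derive_ident z) (derive_ident z))).
    by rewrite mulr_natl mulr2n mul1r mulr1.
  apply: (derive_eq (derive_mul (derive_ident z) (derive_comp dl (dh _ (ray_square a0 ax z01))))).
  by rewrite expr0; ring.
have c01 : {within `[0, 1], continuous (fun z => z ^+ 0 * h (x * z ^+ 2) +
    2 * x * (z ^+ 2 * h' (x * z ^+ 2)))}.
  apply: within_cont => z z01; apply: cont_add.
    exact: (continuous_moment_integrand (n := 0) a0 ax ch z01).
  apply: cont_mul; first exact: cst_continuous.
  exact: (continuous_moment_integrand (n := 2) a0 ax ch' z01).
have := @continuous_FTC2 R _ F 0 1 ltr01 c01.
rewrite /Rintegral => ->.
- by rewrite /F /= mul0r expr1n mulr1 mul1r subr0.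
- have cF (z : R) : z \in `[0, 1] -> {for z, continuous F}.
    by move=> /dF[+ _] => /derivable1_diffP; exact: differentiable_continuous.
  split.
  + by move=> z z01; case: (dF z (subset_itv_oo_cc z01)).
  + apply: cvg_at_right_filter; apply: cF; rewrite in_itv /=; lra.
  + apply: cvg_at_left_filter; apply: cF; rewrite in_itv /=; lra.
- by move=> z z01; rewrite derive1E; case: (dF z (subset_itv_oo_cc z01)).
Qed.

End Moments.

Section LeftSingular.
Context {R : realType}.
Local Notation mu := (@lebesgue_measure R).

Lemma is_derive_continuous (F : R -> R) (x d : R) :
  is_derive x 1 F d -> {for x, continuous F}.
Proof. by case=> + _ => /derivable1_diffP; exact: differentiable_continuous. Qed.

(** The fundamental theorem of calculus when f may be unbounded at a: apply it on
    [s_n, b] with s_n decreasing to a, and pass to the limit by monotone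
    convergence. *)
Lemma ge0_FTC2_left_singular (f F : R -> R) (a b : R) : a < b ->
  (forall x, a < x -> 0 <= f x) ->
  (forall x, a < x -> {for x, continuous f}) ->
  (forall x, a < x -> is_derive x 1 F (f x)) ->
  F x @[x --> a^'+] --> F a ->
  (\int[mu]_(x in `[a, b]) (f x)%:E = (F b - F a)%:E)%E.
Proof.
move=> ab f0 cf dF Fa.
pose s (n : nat) : R := a + (b - a) / n.+1%:R.
have ba : 0 < b - a by rewrite subr_gt0.
have as_ n : a < s n by rewrite ltrDl divr_gt0.
have sb n : s n <= b.
  by rewrite -lerBrDl ler_pdivrMr ?ltr0n // ler_peMr ?ler1n // ltW.
have s_a : s n @[n --> \oo] --> a.
  rewrite -[X in _ --> X]addr0; apply: cvgD; first exact: cvg_cst.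
  rewrite -[X in _ --> X](mulr0 (b - a)); apply: cvgM; first exact: cvg_cst.
  exact: cvg_harmonic.
have s_ni m n : (m <= n)%N -> s n <= s m.
  by move=> mn; rewrite lerD2l ler_pM2l // lef_pV2 ?posrE ?ltr0n // ler_nat.
pose D n : set R := `[s n, b]%classic.
have cD n : {within D n, continuous f}.
  by apply: within_cont => x; rewrite in_itv /= => /andP[sx _]; exact/cf/(lt_le_trans (as_ n)).
have mD n : measurable (D n) by exact: measurable_itv.
have ndD : nondecreasing_seq D.
  move=> m n mn; rewrite subsetEset => x; rewrite /D /= !in_itv /= => /andP[smx ->].
  by rewrite (le_trans (s_ni _ _ mn)).
have UD : \bigcup_n D n = `]a, b]%classic.
  rewrite eqEsubset; split=> x.
    by case=> n _; rewrite /D /= !in_itv /= => /andP[snx ->]; rewrite (lt_le_trans (as_ n)).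
  rewrite /= in_itv /= => /andP[ax xb].
  have /cvgrPdist_lt/(_ (x - a)) := s_a; rewrite subr_gt0 => /(_ ax)[n _ hn].
  exists n => //; rewrite /D /= in_itv /= xb andbT.
  have := hn n (leqnn n); rewrite /= distrC ger0_norm; last by rewrite subr_ge0 ltW.
  by rewrite ltrD2r => /ltW.
have mf n : measurable_fun (D n) f by apply: subspace_continuous_measurable_fun.
have mU : measurable_fun `]a, b] f by rewrite -UD; exact/measurable_fun_bigcup.
rewrite -integral_itv_obnd_cbnd; last exact/measurable_EFinP.
have cvI : (\int[mu]_(x in D n) (f x)%:E)%E @[n --> \oo] -->
    (\int[mu]_(x in `]a, b]) (f x)%:E)%E.
  rewrite -UD; apply: ge0_nondecreasing_set_cvg_integral => //.
    by move=> n; apply/measurable_EFinP; exact: mf.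
  move=> n x; rewrite /D /= in_itv /= lee_fin => /andP[sx _].
  exact/f0/(lt_le_trans (as_ n)).
have EI : \forall n \near \oo, (F b - F (s n))%:E = (\int[mu]_(x in D n) (f x)%:E)%E.
  exists 1%N => // n /= n1.
  have snb : s n < b.
    by rewrite -ltrBrDl ltr_pdivrMr ?ltr0n // ltr_pMr // ltr1n.
  rewrite /D (continuous_FTC2 (F := F)) ?EFinB //; first exact: cD.
  - split.
    + by move=> x; rewrite in_itv /= => /andP[sx _]; case: (dF x (lt_trans (as_ n) sx)).
    + by apply/cvg_at_right_filter/is_derive_continuous/dF.
    + by apply/cvg_at_left_filter/is_derive_continuous/dF.
  - move=> x; rewrite in_itv /= => /andP[sx _]; rewrite derive1E.
    by case: (dF x (lt_trans (as_ n) sx)).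
have cvF : (F b - F (s n))%:E @[n --> \oo] --> (F b - F a)%:E.
  apply: cvg_EFin; first by apply: nearW.
  apply: cvgB; first exact: cvg_cst.
  apply: (cvg_comp _ _ _ Fa).
  move=> A /= [e e0 he].
  have /cvgrPdist_lt/(_ e e0)[n _ hn] := s_a.
  by exists n => // m /= nm; apply: (he (s m)); [exact: hn|exact: as_].
apply: (cvg_unique (@ereal_hausdorff R) cvI); apply: cvg_trans cvF.
exact: near_eq_cvg.
Unshelve. all: by end_near. Qed.

End LeftSingular.

(** * The distance to the zero section *)

Section Radial.
Context {R : realType}.
Local Notation mu := (@lebesgue_measure R).

Lemma smooth_on_shift (U : set R) (c : R) : smooth_on U (fun x => x + c).
Proof. by apply: smooth_on_add; [exact: smooth_on_id|exact: smooth_on_cst]. Qed.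

Lemma smooth_on_V (U : set R) g : (forall x, U x -> g x != 0) ->
  smooth_on U g -> smooth_on U (fun x => (g x)^-1).
Proof.
by move=> g0; apply: (@smooth_on_comp _ U [set x | x != 0] (fun x => x^-1) g) => //;
  exact: smooth_on_inv.
Qed.

(** dt/du for u^2 = w = r - 9/4.  It is smooth across w = 0, unlike dt/dr. *)
Definition speed (w : R) : R :=
  2 * Num.sqrt ((w + 3 / 2) * (w + 3) * (w + 9 / 2)^-1).

Lemma speed_arg_gt0 (w : R) : above (- (3 / 2)) w ->
  0 < (w + 3 / 2) * (w + 3) * (w + 9 / 2)^-1.
Proof. by rewrite /above /= => hw; rewrite !mulr_gt0 ?invr_gt0 //; lra. Qed.

Lemma speed_gt0 (w : R) : above (- (3 / 2)) w -> 0 < speed w.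
Proof. by move=> hw; rewrite mulr_gt0 // sqrtr_gt0; exact: speed_arg_gt0. Qed.

Lemma speed_ge2 (w : R) : 0 <= w -> 2 <= speed w.
Proof.
move=> w0; rewrite /speed ler_pMr // -[leLHS]sqrtr1 ler_sqrt; last first.
  by rewrite divr_ge0 ?mulr_ge0 //; lra.
by rewrite ler_pdivlMr ?mul1r; nra.
Qed.

Lemma smooth_speed : smooth_on (above (- (3 / 2))) speed.
Proof.
apply: smooth_on_mul; first exact: smooth_on_cst.
apply: (@smooth_on_comp _ _ [set x | 0 < x] Num.sqrt); [exact: speed_arg_gt0|
  exact: smooth_on_sqrt|].
apply: smooth_on_mul; first by apply: smooth_on_mul; exact: smooth_on_shift.
by apply: smooth_on_V; [rewrite /above /= => x hx; lra|exact: smooth_on_shift].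
Qed.

(** The mean of dt/du over [0, u]: the integral of speed (v^2) over v in [0, u] is
    u times this, by the substitution v = u z. *)
Definition mean_speed : R -> R := moment 0 speed.

Lemma neg_three_halves : - (3 / 2) < 0 :> R. Proof. lra. Qed.

Lemma smooth_mean_speed : smooth_on (above (- (3 / 2))) mean_speed.
Proof. by apply: (smooth_on_moment _ neg_three_halves); exact: smooth_speed. Qed.

(** t = u mean_speed (u^2) and dt/du = speed (u^2). *)
Lemma mean_speed_derive : exists2 K' : R -> R,
  (forall w, above (- (3 / 2)) w -> is_derive w 1 mean_speed (K' w)) &
  forall w, above (- (3 / 2)) w -> mean_speed w + 2 * w * K' w = speed w.
Proof.
have [k' sk' dk] := smooth_on_derive smooth_speed.
exists (moment 2 k') => w hw.
  by apply: (moment_derive _ neg_three_halves) => // y hy; exact: (smooth_on_continuous sk').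
by apply: (moment_euler neg_three_halves) => // y hy; exact: (smooth_on_continuous sk').
Qed.

Lemma mean_speed_ge (m w : R) : above (- (3 / 2)) w ->
  (forall z, z \in `[0, 1] -> m <= speed (w * z ^+ 2)) -> m <= mean_speed w.
Proof.
move=> hw hm.
have m01 : measurable (`[0, 1] : set R) by exact: measurable_itv.
have -> : m = (\int[mu]_(z in `[0%R, 1%R]) m)%R.
  by rewrite Rintegral_cst //= lebesgue_measure_itv /= lte_fin ltr01 sube0 mulr1.
apply: le_Rintegral => //.
- apply: continuous_compact_integrable; first exact: segment_compact.
  by apply: within_cont => z _; exact: cst_continuous.
  apply: (integrable_moment 0 neg_three_halves hw) => x hx.
  exact: (smooth_on_continuous smooth_speed).
- by move=> z z01; rewrite expr0 mul1r; exact: hm.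
Qed.

Lemma mean_speed_gt0 (w : R) : above (- (3 / 2)) w -> 0 < mean_speed w.
Proof.
move=> hw; pose g (z : R) := speed (w * z ^+ 2).
have cg : {within `[0, 1], continuous g}.
  apply: within_cont => z z01.
  apply: (@cont_comp R (fun z => w * z ^+ 2) speed).
    by apply: cont_mul; [exact: cst_continuous|exact: exprn_continuous].
  by apply: (smooth_on_continuous smooth_speed); exact: ray_square neg_three_halves hw z01.
have [c c01 hc] := EVT_min ler01 cg.
apply: (@lt_le_trans _ _ (g c)); last exact: mean_speed_ge.
by apply: speed_gt0; exact: ray_square neg_three_halves hw c01.
Qed.

Lemma mean_speed_ge2 (w : R) : 0 <= w -> 2 <= mean_speed w.
Proof.
move=> w0; apply: mean_speed_ge; first by rewrite /above /=; lra.
by move=> z _; apply: speed_ge2; rewrite mulr_ge0 // sqr_ge0.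
Qed.

(** t^2 as a function of w = r - 9/4. *)
Definition square_dist (w : R) : R := w * mean_speed w ^+ 2.

(** w (K^2)' + K^2 = K (K + 2 w K') for K = mean_speed. *)
Lemma square_dist_derive (w : R) : above (- (3 / 2)) w ->
  is_derive w 1 square_dist (mean_speed w * speed w).
Proof.
move=> hw; have [K' dK E] := mean_speed_derive.
have dKw := dK w hw.
apply: (derive_eq (derive_mul (derive_ident w) (derive_mul dKw dKw))).
by rewrite -(E w hw); ring.
Qed.

Definition rate (r : R) : R :=
  Num.sqrt ((r - 3 / 4) * (r + 3 / 4) / ((r - 9 / 4) * (r + 9 / 4))).

Definition dist (r : R) : R := Num.sqrt (r - 9 / 4) * mean_speed (r - 9 / 4).

Lemma dist_derive (r : R) : 9 / 4 < r -> is_derive r 1 dist (rate r).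
Proof.
move=> hr; have [K' dK E] := mean_speed_derive.
have w0 : 0 < r - 9 / 4 by rewrite subr_gt0.
have hw : above (- (3 / 2)) (r - 9 / 4) by rewrite /above /=; lra.
have ds : is_derive r 1 (fun x : R => x - 9 / 4) 1.
  by apply: (derive_eq (derive_sub (derive_ident r) (derive_const _ _ _))); rewrite subr0.
apply: (derive_eq (derive_mul (derive_comp ds (is_derive1_sqrt w0)) (derive_comp ds (dK _ hw)))).
have sw : Num.sqrt (r - 9 / 4) ^+ 2 = r - 9 / 4 by rewrite sqr_sqrtr // ltW.
have sn0 : Num.sqrt (r - 9 / 4) != 0 by rewrite gt_eqF // sqrtr_gt0.
transitivity (speed (r - 9 / 4) / (2 * Num.sqrt (r - 9 / 4))).
  rewrite -(E _ hw) -[X in 2 * X * _]sw.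
  by move: (mean_speed _) (K' _) (Num.sqrt _) sn0 => a b s s0; field.
have P0 := speed_arg_gt0 hw; rewrite /speed.
transitivity (Num.sqrt ((r - 9 / 4 + 3 / 2) * (r - 9 / 4 + 3) * (r - 9 / 4 + 9 / 2)^-1) /
              Num.sqrt (r - 9 / 4)).
  by move: (Num.sqrt (_ / _)) (Num.sqrt (r - _)) sn0 => a s s0; field.
rewrite -sqrtrV ?ltW // -sqrtrM; last by rewrite ltW.
rewrite /rate; congr Num.sqrt; field; apply/andP; split; lra.
Qed.

Lemma rate_continuous (r : R) : 9 / 4 < r -> {for r, continuous rate}.
Proof.
move=> hr; apply: (@smooth_on_continuous _ (above (9 / 4))) => //.
apply: (@smooth_on_comp _ _ [set x | 0 < x] Num.sqrt); [|exact: smooth_on_sqrt|].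
  by rewrite /above /= => x hx; rewrite divr_gt0 // mulr_gt0 //; lra.
apply: smooth_on_mul; first by apply: smooth_on_mul; exact: smooth_on_shift.
apply: smooth_on_V; last by apply: smooth_on_mul; exact: smooth_on_shift.
by rewrite /above /= => x hx; rewrite mulf_neq0 //; lra.
Qed.

Lemma dist_94 : dist (9 / 4) = 0.
Proof. by rewrite /dist subrr sqrtr0 mul0r. Qed.

Lemma dist_continuous (r : R) : 9 / 4 <= r -> {for r, continuous dist}.
Proof.
move=> hr.
have cs : {for r, continuous (fun x : R => x - 9 / 4)}.
  exact: (smooth_on_continuous (smooth_on_shift setT (- (9 / 4)))). 
apply: cont_mul.
  exact: (cont_comp cs (@sqrt_continuous _ _)).
apply: (cont_comp cs); apply: (smooth_on_continuous smooth_mean_speed).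
by rewrite /above /=; lra.
Qed.

(** Only the derivative for r > 9/4 and the continuity at 9/4 of the right-hand
    side are used, since the integrand is unbounded near 9/4. *)
Lemma bggg_tE (r : R) : 9 / 4 <= r -> bggg_t r = dist r.
Proof.
rewrite le_eqVlt => /predU1P[<-|hr].
  by rewrite dist_94 /bggg_t set_itv1 Rintegral_set1.
have c94 : dist x @[x --> (9 / 4)^'+] --> dist (9 / 4).
  by apply/cvg_at_right_filter/dist_continuous.
have E := ge0_FTC2_left_singular hr (fun x _ => sqrtr_ge0 _) rate_continuous dist_derive c94.
by rewrite /bggg_t /Rintegral E /= dist_94 subr0.
Qed.

Lemma bggg_t_derive (r : R) : 9 / 4 < r -> is_derive r 1 (@bggg_t R) (rate r).
Proof.
move=> hr; apply: near_eq_is_derive (dist_derive hr).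
have rI : r \in `]9 / 4, +oo[ by rewrite in_itv /= hr.
apply: filterS (near_in_itvoy rI) => x; rewrite in_itv /= andbT => hx.
by rewrite bggg_tE // ltW.
Qed.

Lemma dist_gt0 (r : R) : 9 / 4 < r -> 0 < dist r.
Proof.
move=> hr; rewrite mulr_gt0 ?sqrtr_gt0 ?subr_gt0 // mean_speed_gt0 //.
by rewrite /above /=; lra.
Qed.

Lemma dist_sqr (r : R) : 9 / 4 <= r -> dist r ^+ 2 = square_dist (r - 9 / 4).
Proof. by move=> hr; rewrite exprMn sqr_sqrtr ?subr_ge0. Qed.

End Radial.

(** * The profile *)

Section Inverse.
Context {R : realType}.

Lemma increasing_above (b : R) (h h' : R -> R) :
  (forall x, b < x -> is_derive x 1 h (h' x)) -> (forall x, b < x -> 0 < h' x) ->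
  forall x y, b < x -> x < y -> h x < h y.
Proof.
move=> dh h'0 x y bx xy.
have ch : {within `[x, y], continuous h}.
  apply: within_cont => z; rewrite in_itv /= => /andP[xz _].
  exact/is_derive_continuous/dh/(lt_le_trans bx).
have bz (z : R) : z \in `]x, y[ -> b < z.
  by rewrite in_itv /= => /andP[xz _]; exact: lt_trans xz.
apply: (@gtr0_derive1_lt_cc _ h x y _ _ ch); rewrite ?in_itv /= ?lexx ?(ltW xy) //.
- by move=> z /bz /dh[].
- by move=> z /bz bz'; rewrite derive1E; case: (dh z bz') => _ ->; exact: h'0.
Qed.

Lemma open_above (a : R) : open (above a).
Proof.
have -> : above a = `]a, +oo[%classic by apply/seteqP; split=> x; rewrite /above /= in_itv /= andbT.
exact: interval_open.
Qed.

Lemma near_above (a x : R) : a < x -> \forall y \near x, a < y.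
Proof. by move=> ax; apply: (open_nbhs_nbhs (conj (@open_above a) _)). Qed.

(** The inverse is only wanted above c, for some c > b, so that its domain is an
    open half-line on which the intermediate value theorem provides it. *)
Lemma smooth_inverse (b c : R) (h h' : R -> R) : b < c ->
  smooth_on (above b) h' -> (forall x, b < x -> is_derive x 1 h (h' x)) ->
  (forall x, b < x -> 0 < h' x) -> (forall M, exists2 x, b < x & M <= h x) ->
  exists g, [/\ smooth_on (above (h c)) g, forall x, c < x -> g (h x) = x &
    forall y, h c < y -> c < g y /\ h (g y) = y].
Proof.
move=> bc sh' dh h'0 unb.
have incr := increasing_above dh h'0.
have inj x y : b < x -> b < y -> h x = h y -> x = y.
  move=> bx b_y E; case: (ltgtP x y) => // xy.
    by have := incr _ _ bx xy; rewrite E ltxx.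
  by have := incr _ _ b_y xy; rewrite E ltxx.
have ex y : h c < y -> exists x, c < x /\ h x = y.
  move=> cy; have [x bx yx] := unb y.
  have cx : c < x.
    rewrite ltNge; apply/negP; rewrite le_eqVlt => /predU1P[E|xc].
      by move: (lt_le_trans cy yx); rewrite E ltxx.
    by have := lt_trans (lt_le_trans cy yx) (incr _ _ bx xc); rewrite ltxx.
  have ch : {within `[c, x], continuous h}.
    apply: within_cont => z; rewrite in_itv /= => /andP[cz _].
    exact/is_derive_continuous/dh/(lt_le_trans bc).
  have [|z zcx hz] := IVT (v := y) (ltW cx) ch.
    by rewrite ge_min le_max (ltW cy) yx orbT.
  exists z; split=> //; move: zcx; rewrite in_itv /= => /andP[+ _].
  by rewrite le_eqVlt => /predU1P[E|//]; move: cy; rewrite -hz E ltxx.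
pose g y := xget 0 [set x | c < x /\ h x = y].
have gP y : h c < y -> c < g y /\ h (g y) = y.
  by move=> /ex[x hx]; rewrite /g; case: xgetP => [z _ //|/(_ x)].
have gh x : c < x -> g (h x) = x.
  move=> cx; have [cg E] := gP _ (incr _ _ bc cx).
  by apply: inj E; exact: lt_trans bc _.
exists g; split=> //.
apply: (smooth_on_inverse (U := above b) (h := h) sh' dh).
- by move=> x bx; rewrite gt_eqF // h'0.
- exact: open_above.
- by move=> y /gP[cg E]; split=> //; exact: lt_trans bc cg.
- by move=> y /gP[cg E]; apply: filterS (near_above cg) => x; exact: gh.
- exact: open_above.
Qed.

End Inverse.

Section Profile.
Context {R : realType}.
Variable theta : R.
Hypothesis theta_itv : 0 < theta < pi / 2.

Lemma tan_theta : atan (tan theta) = theta.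
Proof.
have /andP[t0 t1] := theta_itv.
apply: tanK; rewrite in_itv /= t1 andbT (lt_trans _ t0) // oppr_lt0.
by rewrite divr_gt0 // pi_gt0.
Qed.

Lemma tan_theta_gt0 : 0 < tan theta.
Proof.
rewrite ltNge; apply/negP => /(@le_atan R); rewrite tan_theta atan0.
by have /andP[t0 _] := theta_itv; rewrite leNgt t0.
Qed.

(** With m = tan (f/3 + theta), the equation for the profile is
    slope_fun m = slope_value (r - 9/4). *)
Definition slope_fun (m : R) : R := (atan m - theta) * m.
Definition slope_fun' (m : R) : R := (1 + m ^+ 2)^-1 * m + (atan m - theta).

Lemma slope_fun_derive (m : R) : is_derive m 1 slope_fun (slope_fun' m).
Proof.
apply: (derive_eq (derive_mul (derive_sub (is_derive1_atan m) (derive_const _ _ theta))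
  (derive_ident m))).
by rewrite subr0 mulr1.
Qed.

Lemma smooth_slope_fun' : smooth_on setT slope_fun'.
Proof.
apply: smooth_on_add; last first.
  by apply: smooth_on_add; [exact: smooth_on_atan|exact: smooth_on_cst].
apply: smooth_on_mul; last exact: smooth_on_id.
apply: smooth_on_V.
  by move=> x _; rewrite gt_eqF // ltr_pwDl // sqr_ge0.
apply: smooth_on_add; first exact: smooth_on_cst.
by apply: smooth_on_mul; rewrite ?expr1; exact: smooth_on_id.
Qed.

(** slope_fun increases to infinity beyond tan theta, where it vanishes; its
    derivative is still positive a little below tan theta, so that it is
    invertible on a neighbourhood of [tan theta, oo). *)
Lemma slope_fun_inverse : exists c mu, [/\ 0 < c, slope_fun c < 0,
  smooth_on (above (slope_fun c)) mu &
  forall q, slope_fun c < q -> c < mu q /\ slope_fun (mu q) = q].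
Proof.
set m0 := tan theta.
have m00 : 0 < m0 := tan_theta_gt0.
have slope_fun0 : slope_fun m0 = 0 by rewrite /slope_fun tan_theta subrr mul0r.
have p0 : 0 < slope_fun' m0.
  by rewrite /slope_fun' tan_theta subrr addr0 mulr_gt0 // invr_gt0 ltr_pwDl // sqr_ge0.
have cm : {for m0, continuous slope_fun'} by exact: (smooth_on_continuous smooth_slope_fun').
have /nbhs_ballP[e /= e0 he] : \forall x \near m0, 0 < slope_fun' x /\ 0 < x.
  by apply: filterI; [exact: (cvgr_gt _ cm)|exact: near_above].
have e20 : 0 < e / 2 by rewrite divr_gt0.
pose b := m0 - e / 2.
have hb x : b <= x -> 0 < slope_fun' x.
  move=> bx; have [xm|mx] := ltP x m0.
    suff /he[] : ball m0 e x by [].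
    by rewrite /ball /= ger0_norm ?subr_ge0 ?(ltW xm) //; move: bx; rewrite /b; lra.
  rewrite /slope_fun' ltr_pwDl //.
    by apply: mulr_gt0; [rewrite invr_gt0 ltr_pwDl // sqr_ge0|exact: lt_le_trans mx].
  by rewrite subr_ge0 -tan_theta le_atan.
have b0 : 0 < b.
  suff /he[] : ball m0 e b by [].
  by rewrite /ball /= /b opprD opprK addrA subrr add0r gtr0_norm //; lra.
pose c := m0 - e / 4.
have bc : b < c by rewrite /b /c; lra.
have cm0 : c < m0 by rewrite /c; lra.
have incr := increasing_above (b := b) (fun x _ => slope_fun_derive x) (fun x bx => hb x (ltW bx)).
have [|M|mu [smu _ muP]] := smooth_inverse bc _ (fun x _ => slope_fun_derive x)
  (fun x bx => hb x (ltW bx)).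
- exact: smooth_on_sub smooth_slope_fun'.
- pose d := atan (m0 + 1) - theta.
  have d0 : 0 < d by rewrite subr_gt0 -{1}tan_theta lt_atan // ltrDl.
  have Md : 0 <= `|M| / d by rewrite divr_ge0 // ltW.
  exists (m0 + 1 + `|M| / d); first by move: Md bc cm0; move: (`|M| / d) => k; lra.
  apply: (le_trans (ler_norm M)).
  rewrite [leLHS](_ : _ = d * (`|M| / d)); last by rewrite mulrC divfK // gt_eqF.
  apply: ler_pM; [exact: ltW|exact: Md| |].
    by rewrite /d lerD2r; apply: le_atan; rewrite lerDl.
  by move: Md; move: (`|M| / d) => k; lra.
exists c, mu; split=> //.
- exact: lt_trans bc.
- by rewrite -slope_fun0; exact: incr.
Qed.

Definition slope_value (w : R) : R := 2 / 9 * w * (w + 9 / 2).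

Lemma smooth_slope_value U : smooth_on U slope_value.
Proof.
apply: smooth_on_mul; last exact: smooth_on_shift.
by apply: smooth_on_mul; [exact: smooth_on_cst|exact: smooth_on_id].
Qed.

Lemma slope_value_derive (w : R) : is_derive w 1 slope_value (4 / 9 * (w + 9 / 4)).
Proof.
have d1 := derive_scale (2 / 9) (derive_ident w).
have d2 := derive_add (derive_ident w) (derive_const w 1 (9 / 2)).
by apply: (derive_eq (derive_mul d1 d2)); field.
Qed.

(** The profile P as a smooth function of w = r - 9/4, on a neighbourhood of
    [0, oo).  With m = tan (P/3 + theta) one has m P = (2/3) w (w + 9/2), so that
    P / w = (2/3) (w + 9/2) / m is smooth, m being positive.  Differentiating
    this equation and P = 3 (arctan m - theta), then eliminating m', gives
    P' ((1 + m^2) P / 3 + m) = (4/3) (w + 9/4).  The last equation is 3 P times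
    this one, with m P replaced by its value; note that
    w (w + 9/2) = r^2 - 81/16 and (w + 3/2) (w + 3) = r^2 - 9/16. *)
Lemma profile_function : exists w1 P P1, [/\ - (3 / 2) < w1 < 0,
  smooth_on (above w1) P, smooth_on (above w1) P1,
  forall w, w1 < w -> P w = w * P1 w &
  [/\ forall w, 0 <= w -> 0 <= P w,
      forall w, w1 < w -> P w / 3 + theta < pi / 2,
      forall w, w1 < w -> tan (P w / 3 + theta) * P w = 2 / 3 * w * (w + 9 / 2) &
      forall w, w1 < w -> exists2 d, is_derive w 1 P d &
        d * (P w ^+ 2 + 4 / 9 * (w * (w + 9 / 2) * ((w + 3 / 2) * (w + 3)))) =
        4 * (w + 9 / 4) * P w]].
Proof.
have [c [mu [c0 qc smu muP]]] := slope_fun_inverse.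
pose w1 := Num.max (slope_fun c) (- 1).
have w1q w : w1 < w -> slope_fun c < slope_value w.
  rewrite /w1 gt_max => /andP[cw w_1]; have [w0|w0] := ltP w 0.
    by apply: (lt_le_trans cw); rewrite /slope_value; nra.
  by apply: (lt_le_trans qc); rewrite /slope_value; nra.
have w1_itv : - (3 / 2) < w1 < 0.
  rewrite /w1 gt_max qc lt_max /= oppr_lt0 ltr01 andbT; apply/orP; right; lra.
have w1_1 w : w1 < w -> -1 < w by rewrite /w1 gt_max => /andP[].
pose m w := mu (slope_value w).
have sm : smooth_on (above w1) m.
  by apply: (smooth_on_comp w1q smu); exact: smooth_slope_value.
have m0 w : w1 < w -> 0 < m w by move=> /w1q /muP[+ _]; exact: lt_trans.
pose P w := 3 * (atan (m w) - theta).
pose P1 w := 2 / 3 * (w + 9 / 2) * (m w)^-1.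
have sP : smooth_on (above w1) P.
  apply: smooth_on_mul; first exact: smooth_on_cst.
  apply: smooth_on_add; last exact: smooth_on_cst.
  by apply: (@smooth_on_comp _ _ setT atan) => //; exact: smooth_on_atan.
have sP1 : smooth_on (above w1) P1.
  apply: smooth_on_mul; last by apply: smooth_on_V => // w /m0; rewrite lt0r => /andP[].
  by apply: smooth_on_mul; [exact: smooth_on_cst|exact: smooth_on_shift].
have mP w : w1 < w -> m w * P w = 2 / 3 * w * (w + 9 / 2).
  move=> hw; have [_] := muP _ (w1q _ hw); rewrite -/(m w) /slope_fun /slope_value /P => E.
  by rewrite mulrCA [m w * _]mulrC E; field.
have PE w : w1 < w -> P w = w * P1 w.
  move=> hw; have mn0 : m w != 0 by rewrite gt_eqF // m0.
  apply: (mulfI mn0); rewrite mP // /P1.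
  by move: (m w) mn0 => x x0; field.
have tE w : P w / 3 + theta = atan (m w).
  by rewrite /P; field.
exists w1, P, P1; split=> //; split.
- move=> w w0; have hw : w1 < w by case/andP: w1_itv => _ /lt_le_trans; apply.
  rewrite PE // mulr_ge0 // /P1 !mulr_ge0 ?invr_ge0 ?(ltW (m0 _ hw)) //; lra.
- by move=> w _; rewrite tE atan_ltpi2.
- by move=> w hw; rewrite tE atanK mP.
- move=> w hw.
  have [m' _ dm] := smooth_on_derive sm.
  have dP : is_derive w 1 P (3 * ((1 + m w ^+ 2)^-1 * m' w)).
    apply: derive_scale; rewrite -[X in is_derive _ _ _ X]subr0.
    apply: derive_sub (derive_const _ _ _).
    rewrite mulrC.
    by apply: derive_eq (derive_comp (dm _ hw) (is_derive1_atan (m w))) _; rewrite mulrC.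
  exists (3 * ((1 + m w ^+ 2)^-1 * m' w)) => //.
  have d1 := derive_mul (dm _ hw) dP.
  have d2 := derive_scale 3 (slope_value_derive w).
  have d1' : is_derive w 1 (fun x => m x * P x) (3 * (4 / 9 * (w + 9 / 4))).
    apply: near_eq_is_derive d2; apply: filterS (near_above hw) => x hx.
    by rewrite mP // /slope_value; field.
  have E : m' w * P w + m w * (3 * ((1 + m w ^+ 2)^-1 * m' w)) = 3 * (4 / 9 * (w + 9 / 4)).
    by case: d1 => _ <-; case: d1' => _ <-.
  have mPw := mP w hw.
  have n0 : 1 + m w ^+ 2 != 0 by rewrite gt_eqF // ltr_pwDl // sqr_ge0.
  transitivity (3 * (m' w * P w + m w * (3 * ((1 + m w ^+ 2)^-1 * m' w))) * P w); last first.
    by rewrite E; field.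
  have -> : 4 / 9 * (w * (w + 9 / 2) * ((w + 3 / 2) * (w + 3))) =
            (m w * P w) ^+ 2 + 3 * (m w * P w) by rewrite mPw; field.
  by move: (m w) (P w) (m' w) n0 => x y z xn; field.
Qed.

End Profile.

Section RadialSummary.
Context {R : realType}.

(** t >= 2 u for all u >= 0. *)
Lemma square_dist_unbounded (M : R) : exists2 w, - (3 / 2) < w & M <= square_dist w.
Proof.
exists `|M|; first by apply: lt_le_trans (normr_ge0 M); lra.
apply: (le_trans (ler_norm M)); rewrite /square_dist ler_peMr //.
by have := mean_speed_ge2 (normr_ge0 M); nra.
Qed.

Lemma square_dist_inverse (w1 : R) : - (3 / 2) < w1 < 0 -> exists s0 W,
  [/\ s0 < 0, smooth_on (above s0) W, forall w, 0 <= w -> W (square_dist w) = w &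
      forall s, s0 < s -> w1 < W s /\ square_dist (W s) = s].
Proof.
case/andP=> hw1 w10; pose w2 := w1 / 2.
have h2 : - (3 / 2) < w2 by rewrite /w2; lra.
have sS : smooth_on (above (- (3 / 2))) (fun w : R => mean_speed w * speed w).
  by apply: smooth_on_mul; [exact: smooth_mean_speed|exact: smooth_speed].
have pos x : - (3 / 2) < x -> 0 < mean_speed x * speed x :> R.
  by move=> hx; rewrite mulr_gt0 //; [exact: mean_speed_gt0|exact: speed_gt0].
have [W [sW WS SW]] := smooth_inverse h2 sS square_dist_derive pos square_dist_unbounded.
exists (square_dist w2), W; split=> //.
- rewrite /square_dist pmulr_llt0; first by rewrite /w2; lra.
  by rewrite exprn_gt0 // mean_speed_gt0.
- by move=> w w0; apply: WS; rewrite /w2; lra.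
- by move=> s /SW[h ->]; split=> //; apply: lt_trans h; rewrite /w2; lra.
Qed.

Lemma bggg_t_surj (s : R) : 0 < s -> exists2 r : R, 9 / 4 < r & bggg_t r ^+ 2 = s.
Proof.
move=> s0; have [|t0 [W [t00 _ _ hW]]] := @square_dist_inverse (- 1).
  by rewrite oppr_lt0 ltr01 andbT; lra.
have [w1 E] := hW s (lt_trans t00 s0).
have W0 : 0 < W s.
  rewrite ltNge; apply/negP => W0; move: s0; rewrite -E ltNge mulr_le0_ge0 //.
  exact: sqr_ge0.
exists (9 / 4 + W s); first by rewrite ltrDl.
have h : 9 / 4 <= 9 / 4 + W s by rewrite lerDl ltW.
by rewrite bggg_tE // dist_sqr // addrC addKr.
Qed.

Lemma profile_unique (c : R) (f g : R -> R) : 0 < c < pi / 2 ->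
  is_profile c f -> is_profile c g -> forall r, 9 / 4 <= r -> f r = g r.
Proof.
move=> c_itv.
have key (f1 f2 : R -> R) r : is_profile c f1 -> is_profile c f2 -> 9 / 4 <= r ->
    ~ f1 r < f2 r.
  move=> [_ _ p1 b1 e1] [_ _ p2 b2 e2] hr lt12.
  have /andP[_ u1] := b1 r hr; have /andP[_ u2] := b2 r hr.
  have q1 := p1 r hr.
  have c0 : 0 < c by case/andP: c_itv.
  have tin (y : R) : 0 <= y -> y < pi / 2 -> y \in `](- (pi / 2)), (pi / 2)[.
    move=> y0 yp; rewrite in_itv /= yp andbT (lt_le_trans _ y0) // oppr_lt0.
    exact: le_lt_trans yp.
  have i1 h := tin _ h u1; have i2 h := tin _ h u2.
  have h12 : tan (f1 r / 3 + c) < tan (f2 r / 3 + c).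
    rewrite ltr_tan ?ltrD2r ?ltr_pM2r ?invr_gt0 //.
      by apply: i1; rewrite addr_ge0 ?divr_ge0 // ltW.
    by apply: i2; rewrite addr_ge0 ?divr_ge0 // ?p2 // ltW.
  have t1 : 0 < tan (f1 r / 3 + c).
    rewrite -(@tan0 R) ltr_tan //; last 2 first.
    - by apply: tin => //; rewrite divr_gt0 // pi_gt0.
    - by apply: i1; rewrite addr_ge0 ?divr_ge0 // ltW.
    by rewrite ltr_wpDl // divr_ge0.
  by have := e2 r hr; rewrite -(e1 r hr); nra.
move=> pf pg r hr; case: (ltgtP (f r) (g r)) => // h.
- by case: (key _ _ _ pf pg hr).
- by case: (key _ _ _ pg pf hr).
Qed.

(** G is the quotient of P / w by (t^2) / w = mean_speed ^ 2, as a function of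
    t^2. *)
Lemma profile_radial (c : R) : 0 < c < pi / 2 -> exists (g : R -> R) (s0 : R) (G : R -> R),
  [/\ is_profile c g, s0 < 0, smooth_on (above s0) G,
      forall r : R, 9 / 4 <= r -> g r = G (bggg_t r ^+ 2) * bggg_t r ^+ 2 &
      forall r : R, 9 / 4 < r -> exists2 d, is_derive r 1 g d &
        d * (g r ^+ 2 + 4 / 9 * ((r ^+ 2 - 81 / 16) * (r ^+ 2 - 9 / 16))) = 4 * r * g r].
Proof.
move=> c_itv.
have [w1 [P [P1 [w1_itv sP sP1 PE [P0 Pp tP dP]]]]] := profile_function c_itv.
have /andP[w132 w10] := w1_itv.
have [s0 [W [s00 sW WS SW]]] := square_dist_inverse w1_itv.
have shift (r : R) : 9 / 4 <= r -> 0 <= r - 9 / 4 by rewrite subr_ge0.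
have hw1 (r : R) : 9 / 4 <= r -> w1 < r - 9 / 4 by move=> hr; lra.
exists (fun r => P (r - 9 / 4)), s0,
  (fun s => P1 (W s) * (mean_speed (W s) * mean_speed (W s))^-1); split=> //.
- split.
  + apply: within_cont => r; rewrite in_itv /= andbT => hr.
    apply: (@cont_comp R (fun x => x - 9 / 4) P).
      exact: (smooth_on_continuous (smooth_on_shift setT (- (9 / 4)))).
    exact: (smooth_on_continuous sP (hw1 r hr)).
  + by rewrite subrr PE // mul0r.
  + by move=> r hr; apply/P0/shift.
  + move=> r hr; rewrite Pp ?hw1 // andbT addr_ge0 ?divr_ge0 ?P0 ?shift //.
    by case/andP: c_itv => /ltW.
  + move=> r hr; rewrite /=; have := tP _ (hw1 r hr).
    move: (tan (P (r - 9 / 4) / 3 + c)) (P (r - 9 / 4)) => t p E.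
    by rewrite -mulrA E; field.
- have sWm : smooth_on (above s0) (fun s => mean_speed (W s)).
    apply: (@smooth_on_comp _ _ (above (- (3 / 2))) mean_speed W) => //.
      by move=> s /SW[h _]; exact: lt_trans h.
    exact: smooth_mean_speed.
  apply: (@smooth_on_mul _ _ (fun s => P1 (W s))
    (fun s => (mean_speed (W s) * mean_speed (W s))^-1)).
    by apply: (smooth_on_comp _ sP1 sW) => s /SW[].
  apply: smooth_on_V; last exact: smooth_on_mul.
  move=> s /SW[h _]; rewrite mulf_neq0 // gt_eqF // mean_speed_gt0 //;
    exact: lt_trans h.
- move=> r hr; rewrite bggg_tE // dist_sqr // WS ?shift // PE ?hw1 // /square_dist.
  have := @mean_speed_gt0 R (r - 9 / 4); rewrite /above /= => /(_ (lt_trans w132 (hw1 r hr))).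
  rewrite lt0r => /andP[+ _]; move: (mean_speed _) (P1 _) => a b a0; field.
  exact: a0.
- move=> r hr; have [d dd E] := dP _ (hw1 r (ltW hr)).
  exists d.
    have ds : is_derive r 1 (fun x : R => x - 9 / 4) 1.
      by apply: (derive_eq (derive_sub (derive_ident r) (derive_const _ _ _))); rewrite subr0.
    by apply: (derive_eq (derive_comp ds dd)); rewrite mulr1.
  have -> : 4 * r * P (r - 9 / 4) = 4 * (r - 9 / 4 + 9 / 4) * P (r - 9 / 4) by rewrite subrK.
  by rewrite -E; congr (_ * (_ + _ * _)); field.
Qed.

Lemma profile_instanton_ode (p : E1 R) (g d : R) : 9 / 4 < p.1.1 ->
  d * (g ^+ 2 + 4 / 9 * ((p.1.1 ^+ 2 - 81 / 16) * (p.1.1 ^+ 2 - 9 / 16))) = 4 * p.1.1 * g ->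
  d * g ^+ 2 + 4 * (bggg_A2 p * bggg_B2 p) ^+ 2 * d =
    4 * (g * (bggg_A1 p * rate p.1.1) * (bggg_B2 p ^+ 2 - bggg_A2 p ^+ 2)).
Proof.
move=> hr E; rewrite exprMn /bggg_A1 /bggg_A2 /bggg_B2 /rate.
set r := p.1.1 in hr E *.
rewrite -sqrtrM; last by rewrite divr_ge0 // mulr_ge0 //; lra.
have -> : (r - 9 / 4) * (r + 9 / 4) / ((r - 3 / 4) * (r + 3 / 4)) *
    ((r - 3 / 4) * (r + 3 / 4) / ((r - 9 / 4) * (r + 9 / 4))) = 1.
  by field; apply/and4P; split; lra.
rewrite sqrtr1 mulr1 !sqr_sqrtr ?divr_ge0 ?mulr_ge0 //; lra.
Qed.

(** 0 <= f_c < 3 (pi/2 - c). *)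
Lemma profile_uniform (f : R -> R -> R) :
  (forall c, 0 < c < pi / 2 -> is_profile c (f c)) ->
  {uniform [set r | 9 / 4 <= r], f @ at_left (pi / 2) --> cst 0}.
Proof.
move=> hf; move=> A /uniform_nbhs[E [entE EA]].
have [e /= e0 he] := entE.
suff : \forall c \near at_left (pi / 2), A (f c) by [].
have pi2 : 0 < pi / 2 :> R by rewrite divr_gt0 // pi_gt0.
near=> c; apply: EA => r /= hr; apply: he => /=.
have hc : 0 < c < pi / 2 by apply/andP; split; near: c; [exact: nbhs_left_gt|exact: nbhs_left_lt].
have [_ _ p b _] := hf c hc.
have /andP[_ h] := b r hr.
rewrite /ball /= sub0r normrN ger0_norm ?p //.
have : pi / 2 - e / 3 < c by near: c; apply: nbhs_left_gt; rewrite ltrBlDr ltrDl divr_gt0.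
lra.
Unshelve. all: by end_near. Qed.

End RadialSummary.

(** * The equation on the complement of the zero section *)

Section BGGG_algebra.
Variable R : realType.
Local Notation E1 := (E1 R).

(** The coframe (dr, eta_1^+, eta_2^+, eta_3^+, eta_1^-, eta_2^-, eta_3^-): the
    indices 1, 2, 3 stand for eta^+ and 4, 5, 6 for eta^-. *)
Definition frame (p : E1) (i : nat) (w : E1) : R :=
  nth 0 [:: w.1.1; ep1 p (fun=> w); ep2 p (fun=> w); ep3 p (fun=> w);
            em1 p (fun=> w); em2 p (fun=> w); em3 p (fun=> w)] i.

Lemma bggg_psi_extpoly (T : set E1) (p : E1) (t' : R) :
  (forall v, @dt R p v = t' * (v 0).1.1) ->
  is_extpoly (frame p) T p (@bggg_psi R)
    (let w1 := 4 * (bggg_A1 p * bggg_B1 p) in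
     let w2 := 4 * (bggg_A2 p * bggg_B2 p) in
     let o1 := 8 * (bggg_A1 p * bggg_B2 p * bggg_B2 p) in
     let o2 := 8 * (bggg_A2 p * bggg_A2 p * bggg_A1 p) in
     let o3 := 8 * (bggg_B1 p * bggg_B2 p * bggg_A2 p) in
     let om := [:: (w1, [:: 4; 1]%N); (w2, [:: 5; 2]%N); (w2, [:: 6; 3]%N)] in
     scale_terms 2^-1 [seq (t.1 * u.1, t.2 ++ u.2) | t <- om, u <- om] ++
     [:: (- (t' * o1), [:: 0; 1; 5; 6]%N); (t' * o2, [:: 0; 1; 2; 3]%N);
         (- (t' * o3), [:: 0; 4; 5; 3]%N); (- (t' * o3), [:: 0; 4; 2; 6]%N)]).
Proof.
move=> Edt /=.
have e1 : is_extpoly (frame p) T p (@ep1 R) [:: (1, [:: 1%N])] by apply: is_extpoly1.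
have e2 : is_extpoly (frame p) T p (@ep2 R) [:: (1, [:: 2%N])] by apply: is_extpoly1.
have e3 : is_extpoly (frame p) T p (@ep3 R) [:: (1, [:: 3%N])] by apply: is_extpoly1.
have e4 : is_extpoly (frame p) T p (@em1 R) [:: (1, [:: 4%N])] by apply: is_extpoly1.
have e5 : is_extpoly (frame p) T p (@em2 R) [:: (1, [:: 5%N])] by apply: is_extpoly1.
have e6 : is_extpoly (frame p) T p (@em3 R) [:: (1, [:: 6%N])] by apply: is_extpoly1.
have e0 : is_extpoly (frame p) T p (@dt R) [:: (t', [:: 0%N])].
  move=> v Tv; rewrite Edt /extpoly big_seq1 /= /monomial.
  by rewrite [X in \det X]mx11_scalar det_scalar1 !mxE.
have eo : is_extpoly (frame p) T p (@bggg_omega R)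
   [:: (4 * (bggg_A1 p * bggg_B1 p), [:: 4; 1]%N); (4 * (bggg_A2 p * bggg_B2 p), [:: 5; 2]%N);
     (4 * (bggg_A2 p * bggg_B2 p), [:: 6; 3]%N)].
  have := is_extpolyD (is_extpolyM (4 \*o (@bggg_A1 R \* @bggg_B1 R)) (is_extpoly_wedge e4 e1 isT))
    (is_extpolyM (4 \*o (@bggg_A2 R \* @bggg_B2 R))
      (is_extpolyD (is_extpoly_wedge e5 e2 isT) (is_extpoly_wedge e6 e3 isT))).
  by rewrite /= !mulr1.
have eO := is_extpolyD (is_extpolyB
  (is_extpolyM (8 \*o (@bggg_A1 R \* @bggg_B2 R \* @bggg_B2 R))
    (is_extpoly_wedge (is_extpoly_wedge e1 e5 isT) e6 isT))
  (is_extpolyM (8 \*o (@bggg_A2 R \* @bggg_A2 R \* @bggg_A1 R))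
    (is_extpoly_wedge (is_extpoly_wedge e1 e2 isT) e3 isT)))
  (is_extpolyM (8 \*o (@bggg_B1 R \* @bggg_B2 R \* @bggg_A2 R))
    (is_extpolyD (is_extpoly_wedge (is_extpoly_wedge e4 e5 isT) e3 isT)
       (is_extpoly_wedge (is_extpoly_wedge e4 e2 isT) e6 isT))).
have := is_extpolyB (is_extpolyM (cst 2^-1) (is_extpoly_wedge eo eo isT))
          (is_extpoly_wedge e0 eO isT).
by rewrite /= !mulr1 !mulN1r !mulrN opprK.
Qed.

(** After sorting, all remaining monomials of F^3 / 6 - F /\ psi are
    dr /\ eta_123^+++ /\ eta_23^--, and its coefficient is 4 times the difference of
    the two sides of the differential equation. *)
Lemma instanton_from_ode (T : set E1) (p : E1) (F : form E1 2) (f f' t' : R) :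
  (forall v, @dt R p v = t' * (v 0).1.1) ->
  is_extpoly (frame p) T p F
    [:: (f', [:: 0; 1]%N); (- 2 * f, [:: 2; 3]%N); (- 2 * f, [:: 5; 6]%N)] ->
  f' * f ^+ 2 + 4 * (bggg_A2 p * bggg_B2 p) ^+ 2 * f' =
    4 * (f * (bggg_A1 p * t') * (bggg_B2 p ^+ 2 - bggg_A2 p ^+ 2)) ->
  forall v, (forall i, T (v i)) ->
  fsub (fmul (cst 6^-1) (wedge (wedge F F) F : form E1 6)) (wedge F (@bggg_psi R)) p v = 0.
Proof.
move=> Edt EF ode v Tv.
have EL := is_extpolyB
  (is_extpolyM (cst 6^-1) (is_extpoly_wedge (is_extpoly_wedge EF EF isT) EF isT))
  (is_extpoly_wedge EF (bggg_psi_extpoly Edt) isT).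
rewrite (EL v Tv) {EL}; set L := (X in extpoly _ X).
rewrite extpoly_normal; last by vm_compute.
rewrite /L /normal_terms /= /extpoly !big_cons big_nil /=.
move: (monomial _ _ v) ode.
move: (bggg_A1 p) (bggg_A2 p) (bggg_B2 p) => A1 A2 B2 D ode.
transitivity (4 * D * ((f' * f ^+ 2 + 4 * (A2 * B2) ^+ 2 * f') -
    4 * (f * (A1 * t') * (B2 ^+ 2 - A2 ^+ 2)))); first by field.
by rewrite ode subrr mulr0.
Qed.

End BGGG_algebra.

(** * Quaternions *)

Section QuaternionAlgebra.
Context {R : realType}.
Local Notation H := ('rV[R]_4).
Implicit Types x y z a : H.

Lemma quatP x y : q0 x = q0 y -> q1 x = q1 y -> q2 x = q2 y -> q3 x = q3 y -> x = y.
Proof.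
move=> e0 e1 e2 e3; apply/rowP => -[[|[|[|[|//]]]] h].
- by move: e0; rewrite /q0 (bool_irrelevance h isT).
- by move: e1; rewrite /q1 (bool_irrelevance h isT).
- by move: e2; rewrite /q2 (bool_irrelevance h isT).
- by move: e3; rewrite /q3 (bool_irrelevance h isT).
Qed.

Lemma quatE (a b c d : R) : (q0 (quat a b c d) = a) * (q1 (quat a b c d) = b) *
  (q2 (quat a b c d) = c) * (q3 (quat a b c d) = d).
Proof. by rewrite /q0 /q1 /q2 /q3 /quat !mxE. Qed.

Lemma quat_eta x : quat (q0 x) (q1 x) (q2 x) (q3 x) = x.
Proof. by apply: quatP; rewrite quatE. Qed.

Lemma qD x y : (q0 (x + y) = q0 x + q0 y) * (q1 (x + y) = q1 x + q1 y) *
  (q2 (x + y) = q2 x + q2 y) * (q3 (x + y) = q3 x + q3 y).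
Proof. by rewrite /q0 /q1 /q2 /q3 !mxE. Qed.

Lemma qZ (k : R) x : (q0 (k *: x) = k * q0 x) * (q1 (k *: x) = k * q1 x) *
  (q2 (k *: x) = k * q2 x) * (q3 (k *: x) = k * q3 x).
Proof. by rewrite /q0 /q1 /q2 /q3 !mxE. Qed.

Lemma qN x : (q0 (- x) = - q0 x) * (q1 (- x) = - q1 x) *
  (q2 (- x) = - q2 x) * (q3 (- x) = - q3 x).
Proof. by rewrite /q0 /q1 /q2 /q3 !mxE. Qed.

Definition qE := (quatE, qD, qZ, qN).

Lemma qmulA x y z : qmul x (qmul y z) = qmul (qmul x y) z.
Proof. by apply: quatP; rewrite /qmul !quatE; ring. Qed.

Lemma qmulDl x y z : qmul (x + y) z = qmul x z + qmul y z.
Proof. by apply: quatP; rewrite /qmul !qE; ring. Qed.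

Lemma qmulDr x y z : qmul z (x + y) = qmul z x + qmul z y.
Proof. by apply: quatP; rewrite /qmul !qE; ring. Qed.

Lemma qmulZl (k : R) x y : qmul (k *: x) y = k *: qmul x y.
Proof. by apply: quatP; rewrite /qmul !qE; ring. Qed.

Lemma qmulZr (k : R) x y : qmul x (k *: y) = k *: qmul x y.
Proof. by apply: quatP; rewrite /qmul !qE; ring. Qed.

Lemma qconjD x y : qconj (x + y) = qconj x + qconj y.
Proof. by apply: quatP; rewrite /qconj !qE //; ring. Qed.

Lemma qconjZ (k : R) x : qconj (k *: x) = k *: qconj x.
Proof. by apply: quatP; rewrite /qconj !qE //; ring. Qed.

Lemma qconjM x y : qconj (qmul x y) = qmul (qconj y) (qconj x).
Proof. by apply: quatP; rewrite /qconj /qmul !quatE; ring. Qed.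

Lemma qconjK x : qconj (qconj x) = x.
Proof. by apply: quatP; rewrite /qconj !quatE ?opprK. Qed.

Definition qone : H := quat 1 0 0 0.

Lemma qmul1 x : qmul x qone = x.
Proof. by apply: quatP; rewrite /qmul !quatE; ring. Qed.

Lemma qmul1l x : qmul qone x = x.
Proof. by apply: quatP; rewrite /qmul !quatE; ring. Qed.

Lemma qconj1 : qconj qone = qone.
Proof. by apply: quatP; rewrite /qone /qconj !quatE ?oppr0. Qed.

Lemma qmul_conjl a : qdot a a = 1 -> qmul (qconj a) a = qone.
Proof. by rewrite /qdot /qone => <-; apply: quatP; rewrite /qmul /qconj !quatE; ring. Qed.

Lemma qmul_conjr a : qdot a a = 1 -> qmul a (qconj a) = qone.
Proof. by rewrite /qdot /qone => <-; apply: quatP; rewrite /qmul /qconj !quatE; ring. Qed.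

Lemma qdotE x y : qdot x y = q0 (qmul (qconj x) y).
Proof. by rewrite /qdot /qmul /qconj !quatE; ring. Qed.

(** The T_1-component of x^-1 y, for x a unit quaternion.  The form eta_1^+ is
    half the sum of im1 (a, da) and im1 (b, db). *)
Definition im1 x y : R := q1 (qmul (qconj x) y).

Lemma im1E x y : im1 x y = q0 x * q1 y - q1 x * q0 y - q2 x * q3 y + q3 x * q2 y.
Proof. by rewrite /im1 /qmul /qconj !quatE; ring. Qed.

Lemma im1Dl x y z : im1 (x + y) z = im1 x z + im1 y z.
Proof. by rewrite !im1E !qE; ring. Qed.

Lemma im1Dr x y z : im1 z (x + y) = im1 z x + im1 z y.
Proof. by rewrite !im1E !qE; ring. Qed.

Lemma im1Zl (k : R) x y : im1 (k *: x) y = k * im1 x y.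
Proof. by rewrite !im1E !qE; ring. Qed.

Lemma im1Zr (k : R) x y : im1 x (k *: y) = k * im1 x y.
Proof. by rewrite !im1E !qE; ring. Qed.

Lemma im1_one x : im1 qone x = q1 x.
Proof. by rewrite im1E /qone !quatE; ring. Qed.

Lemma im1_mull a x y : qdot a a = 1 -> im1 (qmul a x) (qmul a y) = im1 x y.
Proof. by move=> a1; rewrite /im1 qconjM -qmulA (qmulA (qconj a)) qmul_conjl // qmul1l. Qed.

End QuaternionAlgebra.

(** * The curvature on the complement *)

Section Curvature.
Variable R : realType.
Local Notation E1 := (E1 R).

Lemma lift_ord3 : (lift ord0 (@Ordinal 3 0 isT) = @Ordinal 4 1 isT) *
  (lift ord0 (@Ordinal 3 1 isT) = @Ordinal 4 2 isT) *
  (lift ord0 (@Ordinal 3 2 isT) = @Ordinal 4 3 isT).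
Proof. by split; [split|]; apply: val_inj. Qed.

Lemma ep1E (p : E1) (v : 'I_1 -> E1) :
  ep1 p v = 2^-1 * (im1 p.1.2 (v 0).1.2 + im1 p.2 (v 0).2).
Proof.
rewrite /ep1 /etap /im1 /q1.
by rewrite !lift_ord3.
Qed.

(** The coefficients of eta_1^+ are linear in the point; hence its derivative in
    the direction v is again given by this formula, at v in place of the
    point. *)
Definition ep1_bil (p v : E1) : R := 2^-1 * (im1 p.1.2 v.1.2 + im1 p.2 v.2).

Lemma ep1_bil_derive (p v w : E1) : is_derive p v (ep1_bil ^~ w) (ep1_bil v w).
Proof.
apply: derive_affine => h; rewrite /ep1_bil /= !im1Dl !im1Zl; ring.
Qed.

Lemma radial_derive (p v : E1) (g : R -> R) (d : R) : is_derive p.1.1 1 g d ->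
  is_derive p v (fun q : E1 => g q.1.1) (d * v.1.1).
Proof.
move=> dg; apply: (derive_comp (g := fun q : E1 => q.1.1)) dg.
by apply: derive_affine => h /=; rewrite addrC.
Qed.

Lemma dt_eval (p : E1) (v : 'I_1 -> E1) : 9 / 4 < p.1.1 ->
  dt p v = rate p.1.1 * (v 0).1.1.
Proof.
move=> hr; rewrite /dt /extd big_ord1 expr0 mul1r /form0.
by have [_ ->] := radial_derive (v 0) (bggg_t_derive hr).
Qed.

Lemma curvature_eval (p : E1) (v : 'I_2 -> E1) (g : R -> R) (d : R) :
  is_derive p.1.1 1 g d ->
  let v0 := v ord0 in let v1 := v (lift ord0 ord0) in
  extd (connection g) p v =
    d * (v0.1.1 * ep1_bil p v1 - v1.1.1 * ep1_bil p v0) +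
    g p.1.1 * (ep1_bil v0 v1 - ep1_bil v1 v0).
Proof.
move=> dg v0 v1; rewrite /extd !big_ord_recl big_ord0 /= addr0 expr0 expr1 mul1r mulN1r.
have D (u w : E1) : 'D_u (fun q : E1 => g q.1.1 * ep1_bil q w) p =
    d * u.1.1 * ep1_bil p w + g p.1.1 * ep1_bil u w.
  by have [_ ->] := derive_mul (radial_derive u dg) (ep1_bil_derive p u w).
have F (i : 'I_2) (w : E1) : v (lift i 0) = w ->
    (fun q => connection g q (fun j => v (lift i j))) = (fun q : E1 => g q.1.1 * ep1_bil q w).
  by move=> <-; apply/funext => q; rewrite /connection /fmul ep1E.
rewrite (F ord0 v1); last by congr v; apply: val_inj.
rewrite (F (lift ord0 ord0) v0); last by congr v; apply: val_inj.
rewrite !D; ring.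
Qed.

(** The Maurer-Cartan equation: for x = a X and y = a Y with X and Y imaginary,
    im1 (x, y) is the T_1-component of - X Y. *)
Lemma im1_tangent (a x y : 'rV[R]_4) : qdot a a = 1 -> qdot a x = 0 -> qdot a y = 0 ->
  im1 x y = - (q2 (qmul (qconj a) x) * q3 (qmul (qconj a) y) -
               q3 (qmul (qconj a) x) * q2 (qmul (qconj a) y)).
Proof.
move=> a1 ax ay; rewrite -[LHS]mul1r -a1.
transitivity (qdot a x * im1 a y - im1 a x * qdot a y -
   (q2 (qmul (qconj a) x) * q3 (qmul (qconj a) y) -
               q3 (qmul (qconj a) x) * q2 (qmul (qconj a) y))).
  by rewrite !im1E /qdot /qmul /qconj !quatE; ring.
by rewrite ax ay mul0r mulr0 subrr sub0r.
Qed.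

Lemma monomial2 (V : normedModType R) (e : nat -> V -> R) i j (v : 'I_2 -> V) :
  monomial e [:: i; j] v = e i (v ord0) * e j (v (lift ord0 ord0)) -
                         e i (v (lift ord0 ord0)) * e j (v ord0).
Proof.
rewrite /monomial (expand_det_row _ ord0) !big_ord_recl big_ord0 addr0 /cofactor !det_mx11 !mxE /=.
rewrite expr0 expr1 mul1r mulN1r mulrN; congr (_ * e _ (v _) - _ * e _ (v _)); exact: val_inj.
Qed.

(** d eta_1^+ = - 2 (eta_23^++ + eta_23^--): the derivatives of the two halves of
    eta_1^+ are given by [im1_tangent], and the T_i-components of a^-1 da and
    b^-1 db are eta_i^+ + eta_i^- and eta_i^+ - eta_i^-. *)
Lemma curvature_extpoly (p : E1) (g : R -> R) (d : R) : M1 p -> is_derive p.1.1 1 g d ->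
  is_extpoly (frame p) (T1 p) p (extd (connection g))
    [:: (d, [:: 0; 1]%N); (- 2 * g p.1.1, [:: 2; 3]%N); (- 2 * g p.1.1, [:: 5; 6]%N)].
Proof.
move=> [_ a1 b1] dg v Tv; rewrite (curvature_eval v dg) /extpoly !big_cons big_nil /= !monomial2.
set v0 := v ord0; set v1 := v _.
have [a0 b0] : T1 p v0 by exact: Tv.
have [a1' b1'] : T1 p v1 by exact: Tv.
have fE : [/\ forall w, frame p 0 w = w.1.1, forall w, frame p 1 w = ep1_bil p w,
  (forall w, frame p 2 w = 2^-1 * (q2 (qmul (qconj p.1.2) w.1.2) + q2 (qmul (qconj p.2) w.2))) /\
  (forall w, frame p 3 w = 2^-1 * (q3 (qmul (qconj p.1.2) w.1.2) + q3 (qmul (qconj p.2) w.2))),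
  forall w, frame p 5 w = 2^-1 * (q2 (qmul (qconj p.1.2) w.1.2) - q2 (qmul (qconj p.2) w.2)) &
  forall w, frame p 6 w = 2^-1 * (q3 (qmul (qconj p.1.2) w.1.2) - q3 (qmul (qconj p.2) w.2))].
  split=> [//|w||w|w]; first exact: ep1E.
  - by split=> w; rewrite /frame /= /ep2 /ep3 /etap /q2 /q3 !lift_ord3.
  - by rewrite /frame /= /em2 /etam /q2 !lift_ord3.
  - by rewrite /frame /= /em3 /etam /q3 !lift_ord3.
have [f0 f1 [f2 f3] f5 f6] := fE.
rewrite !f0 !f1 !f2 !f3 !f5 !f6.
rewrite {3 4}/ep1_bil (im1_tangent a1 a0 a1') (im1_tangent b1 b0 b1').
rewrite (im1_tangent a1 a1' a0) (im1_tangent b1 b1' b0).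
by field.
Qed.

Lemma instanton_on_complement (c : R) (f : R -> R) : 0 < c < pi / 2 -> is_profile c f ->
  deformed_G2_instanton (@M1 R) (@T1 R) (@bggg_psi R) (connection f).
Proof.
move=> hc pf F p Mp v Tv.
have hr : 9 / 4 < p.1.1 by case: Mp.
have [g [s0 [G [pg _ _ _ dg]]]] := profile_radial hc.
have [d dd ode] := dg _ hr.
have fg : is_derive p.1.1 1 f d.
  apply: near_eq_is_derive dd.
  apply: filterS (near_above hr) => x hx; exact: (profile_unique hc pg pf (ltW hx)).
apply: (instanton_from_ode (T := T1 p) (fun v => dt_eval v hr) (curvature_extpoly Mp fg)) => //.
apply: profile_instanton_ode => //.
by rewrite (profile_unique hc pf pg (ltW hr)).
Qed.

End Curvature.

(** * The connection on the total space *)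

Section SmoothFunctions.
Variable R : realType.
Local Notation E2 := (E2 R).

Lemma coord_differentiable (V : normedModType R) (f : V -> 'rV[R]_4) (p : V) i :
  differentiable f p -> differentiable (fun q => f q 0 i) p.
Proof.
move=> df; apply: (@differentiable_comp _ _ _ _ f (fun M : 'rV[R]_4 => M 0 i)) => //.
exact: differentiable_coord.
Qed.

Lemma fst_differentiable (V W : normedModType R) (p : V * W) : differentiable (@fst V W) p.
Proof. by apply: linear_differentiable => q; exact: cvg_fst. Qed.

Lemma snd_differentiable (V W : normedModType R) (p : V * W) : differentiable (@snd V W) p.
Proof. by apply: linear_differentiable => q; exact: cvg_snd. Qed.

(** The functions of (x, q) generated by the coordinates and by the functions
    k (|x|^2) with k in F.  When F is stable under differentiation, this algebra
    is stable under all directional derivatives. *)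
Inductive radial_algebra (F : (R -> R) -> Prop) : (E2 -> R) -> Prop :=
| ra_cst c : radial_algebra F (fun=> c)
| ra_coord1 i : radial_algebra F (fun P => P.1 0 i)
| ra_coord2 i : radial_algebra F (fun P => P.2 0 i)
| ra_radial k : F k -> radial_algebra F (fun P => k (qdot P.1 P.1))
| ra_add g h : radial_algebra F g -> radial_algebra F h ->
    radial_algebra F (fun P => g P + h P)
| ra_mul g h : radial_algebra F g -> radial_algebra F h ->
    radial_algebra F (fun P => g P * h P).

Lemma ra_sub F g h : radial_algebra F g -> radial_algebra F h ->
  radial_algebra F (fun P => g P - h P).
Proof.
move=> Fg Fh; rewrite (_ : (fun P => _) = (fun P => g P + -1 * h P)).
  by apply: ra_add => //; apply: ra_mul => //; exact: ra_cst.
by apply/funext => P; rewrite mulN1r.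
Qed.

Lemma ra_opp F g : radial_algebra F g -> radial_algebra F (fun P => - g P).
Proof.
move=> Fg; rewrite (_ : (fun P => _) = (fun P => -1 * g P)).
  by apply: ra_mul => //; exact: ra_cst.
by apply/funext => P; rewrite mulN1r.
Qed.

Definition ra_quat F (X : E2 -> 'rV[R]_4) : Prop :=
  [/\ radial_algebra F (fun P => q0 (X P)), radial_algebra F (fun P => q1 (X P)),
      radial_algebra F (fun P => q2 (X P)) & radial_algebra F (fun P => q3 (X P))].

Lemma ra_fst F : ra_quat F (fun P => P.1).
Proof. by split; exact: ra_coord1. Qed.

Lemma ra_snd F : ra_quat F (fun P => P.2).
Proof. by split; exact: ra_coord2. Qed.

Lemma ra_quat_cst F x : ra_quat F (fun=> x).
Proof. by split; exact: ra_cst. Qed.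

Lemma ra_qconj F X : ra_quat F X -> ra_quat F (fun P => qconj (X P)).
Proof.
case=> x0 x1 x2 x3; split; under eq_fun do rewrite /qconj quatE //; first exact: x0;
  exact: ra_opp.
Qed.

Lemma ra_qmul F X Y : ra_quat F X -> ra_quat F Y -> ra_quat F (fun P => qmul (X P) (Y P)).
Proof.
case=> x0 x1 x2 x3 [y0 y1 y2 y3].
split; under eq_fun do rewrite /qmul quatE;
  by repeat (first [apply: ra_mul|apply: ra_sub|apply: ra_add]).
Qed.

Lemma ra_im1 F X Y : ra_quat F X -> ra_quat F Y ->
  radial_algebra F (fun P => im1 (X P) (Y P)).
Proof. by move=> hX hY; case: (ra_qmul (ra_qconj hX) hY). Qed.

Lemma normsq_derive (P V : E2) :
  is_derive P V (fun Q : E2 => qdot Q.1 Q.1) (2 * qdot P.1 V.1).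
Proof.
apply: (@derive_cubic _ _ _ _ _ _ (qdot V.1 V.1) 0) => h.
rewrite /qdot /= !qE; ring.
Qed.

Lemma ra_continuous (U : set R) F g : (forall s, 0 <= s -> U s) ->
  (forall k, F k -> exists2 k', F k' & forall x, U x -> is_derive x 1 k (k' x)) ->
  radial_algebra F g -> continuous g.
Proof.
move=> U0 dF; elim=> {g} [c|i|i|k Fk|g h _ cg _ ch|g h _ cg _ ch] P.
- exact: cst_continuous.
- apply: differentiable_continuous; apply: coord_differentiable; exact: fst_differentiable.
- apply: differentiable_continuous; apply: coord_differentiable; exact: snd_differentiable.
- have cN : {for P, continuous (fun Q : E2 => qdot Q.1 Q.1)}.
    have c1 i : {for P, continuous (fun Q : E2 => Q.1 0 i)}.
      apply: differentiable_continuous; apply: coord_differentiable.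
      exact: fst_differentiable.
    by apply: cvgD; [apply: cvgD; [apply: cvgD|]|]; apply: cvgM; exact: c1.
  apply: (continuous_comp (f := fun Q : E2 => qdot Q.1 Q.1) (g := k)) => //.
  have [k' _ dk] := dF k Fk; apply: is_derive_continuous; apply: dk; apply: U0.
  by rewrite /qdot -!expr2 !addr_ge0 ?sqr_ge0.
- by apply: cvgD; [exact: cg|exact: ch].
- by apply: cvgM; [exact: cg|exact: ch].
Qed.

Lemma ra_derive (U : set R) F g (V : E2) : (forall s, 0 <= s -> U s) ->
  (forall k, F k -> exists2 k', F k' & forall x, U x -> is_derive x 1 k (k' x)) ->
  radial_algebra F g -> exists2 g', radial_algebra F g' & forall P, is_derive P V g (g' P).
Proof.
move=> U0 dF; elim=> {g} [c|i|i|k Fk|g h Fg [g' Fg' dg] Fh [h' Fh' dh]|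
   g h Fg [g' Fg' dg] Fh [h' Fh' dh]].
- by exists (fun=> 0); [exact: ra_cst|move=> P; exact: derive_const].
- exists (fun=> V.1 0 i); first exact: ra_cst.
  by move=> P; apply: derive_affine => h /=; rewrite !mxE addrC.
- exists (fun=> V.2 0 i); first exact: ra_cst.
  by move=> P; apply: derive_affine => h /=; rewrite !mxE addrC.
- have [k' Fk' dk] := dF k Fk.
  exists (fun P => k' (qdot P.1 P.1) * (2 * qdot P.1 V.1)).
    apply: ra_mul; first exact: ra_radial.
    apply: ra_mul; first exact: ra_cst.
    rewrite /qdot; repeat (first [apply: ra_mul|apply: ra_add]);
      first [exact: ra_coord1|exact: ra_cst].
  move=> P; apply: (derive_comp (normsq_derive P V)); apply: dk; apply: U0.
  by rewrite /qdot -!expr2 !addr_ge0 ?sqr_ge0.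
- exists (fun P => g' P + h' P); first exact: ra_add.
  by move=> P; exact: derive_add.
- exists (fun P => g' P * h P + g P * h' P); first by apply: ra_add; apply: ra_mul.
  by move=> P; exact: derive_mul.
Qed.

Lemma ra_smooth (U : set R) F g : (forall s, 0 <= s -> U s) ->
  (forall k, F k -> exists2 k', F k' & forall x, U x -> is_derive x 1 k (k' x)) ->
  radial_algebra F g -> smooth g.
Proof.
move=> U0 dF Fg s h.
have Fh : radial_algebra F h.
  rewrite /h {h}; elim: s => [//|v s IH] /=.
  have [g' Fg' dg] := ra_derive v U0 dF IH.
  rewrite (_ : (fun _ => _) = g') //; apply/funext => P; by case: (dg P) => _ <-.
split; first exact: ra_continuous U0 dF Fh.
by move=> v P; have [g' _ /(_ P)[]] := ra_derive v U0 dF Fh.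
Qed.

End SmoothFunctions.

Section ExtendedConnection.
Variable R : realType.
Local Notation E1 := (E1 R).
Local Notation E2 := (E2 R).

(** The form that pulls back to t^2 eta_1^+ under x = t a, q = a b^-1.  Indeed
    b = q^-1 a gives b^-1 db = a^-1 da - a^-1 dq q^-1 a, so that eta_1^+ is the
    T_1-component of a^-1 da - a^-1 dq q^-1 a / 2. *)
Definition alpha (P V : E2) : R :=
  im1 P.1 V.1 - 2^-1 * im1 P.1 (qmul (qmul V.2 (qconj P.2)) P.1).

(** The derivative of alpha in the direction V, evaluated on W. *)
Definition dalpha (P V W : E2) : R :=
  im1 V.1 W.1 - 2^-1 * (im1 V.1 (qmul (qmul W.2 (qconj P.2)) P.1) +
    im1 P.1 (qmul (qmul W.2 (qconj V.2)) P.1) + im1 P.1 (qmul (qmul W.2 (qconj P.2)) V.1)).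

(** Since eta_1^+ is t^-2 alpha and f = G (t^2) t^2, this is f eta_1^+. *)
Definition extension (G : R -> R) : form E2 1 :=
  fun P v => G (qdot P.1 P.1) * alpha P (v 0).

Lemma alpha_derive (P V W : E2) : is_derive P V (alpha ^~ W) (dalpha P V W).
Proof.
apply: (@derive_cubic _ _ _ _ _ _
  (- 2^-1 * (im1 V.1 (qmul (qmul W.2 (qconj V.2)) P.1) +
             im1 V.1 (qmul (qmul W.2 (qconj P.2)) V.1) +
             im1 P.1 (qmul (qmul W.2 (qconj V.2)) V.1)))
  (- 2^-1 * im1 V.1 (qmul (qmul W.2 (qconj V.2)) V.1))) => h.
rewrite /alpha /dalpha /= qconjD qconjZ.
rewrite !(qmulDr, qmulDl, qmulZl, qmulZr, im1Dl, im1Dr, im1Zl, im1Zr, scalerDr); ring.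
Qed.

Lemma smooth_extension (s0 : R) (G : R -> R) : s0 < 0 -> smooth_on (above s0) G ->
  smooth_form (extension G).
Proof.
move=> s00 [F FG dF]; split=> [P|v].
  split=> [v i a x y|v i j]; last by rewrite (ord1 i) (ord1 j) eqxx.
  have E z : dfwith v i z 0 = z by rewrite (ord1 i) dfwithin.
  rewrite /extension !E /alpha /=.
  rewrite !(qmulDr, qmulDl, qmulZl, qmulZr, im1Dl, im1Dr, im1Zl, im1Zr); ring.
apply: (@ra_smooth _ (above s0) F) => //; first by move=> s hs; exact: lt_le_trans hs.
apply: ra_mul; first exact: ra_radial.
apply: ra_sub; first by apply: ra_im1; [exact: ra_fst|exact: ra_quat_cst].
apply: ra_mul; first exact: ra_cst.
apply: ra_im1; first exact: ra_fst.
apply: ra_qmul; last exact: ra_fst.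
by apply: ra_qmul; [exact: ra_quat_cst|apply: ra_qconj; exact: ra_snd].
Qed.

Lemma extd_extension (G : R -> R) (P : E2) (v : 'I_2 -> E2) (d : R) :
  is_derive (qdot P.1 P.1) 1 G d ->
  let v0 := v ord0 in let v1 := v (lift ord0 ord0) in
  extd (extension G) P v =
    d * (2 * qdot P.1 v0.1 * alpha P v1 - 2 * qdot P.1 v1.1 * alpha P v0) +
    G (qdot P.1 P.1) * (dalpha P v0 v1 - dalpha P v1 v0).
Proof.
move=> dG v0 v1; rewrite /extd !big_ord_recl big_ord0 /= addr0 expr0 expr1 mul1r mulN1r.
have D (u w : E2) : 'D_u (fun q : E2 => G (qdot q.1 q.1) * alpha q w) P =
    d * (2 * qdot P.1 u.1) * alpha P w + G (qdot P.1 P.1) * dalpha P u w.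
  by have [_ ->] := derive_mul (derive_comp (normsq_derive P u) dG) (alpha_derive P u w).
have F (i : 'I_2) (w : E2) : v (lift i 0) = w ->
    (fun q => extension G q (fun j => v (lift i j))) = (fun q : E2 => G (qdot q.1 q.1) * alpha q w).
  by move=> <-.
rewrite (F ord0 v1); last by congr v; apply: val_inj.
rewrite (F (lift ord0 ord0) v0); last by congr v; apply: val_inj.
rewrite !D; ring.
Qed.

End ExtendedConnection.

(** * The map from the complement to the total space *)

Section ComplementMap.
Variable R : realType.
Local Notation E1 := (E1 R).
Local Notation E2 := (E2 R).
Local Notation H := ('rV[R]_4).

Lemma diff_quat (V : normedModType R) (f0 f1 f2 f3 : V -> R) (p v : V) (d0 d1 d2 d3 : R) :
  differentiable f0 p -> differentiable f1 p -> differentiable f2 p -> differentiable f3 p ->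
  is_derive p v f0 d0 -> is_derive p v f1 d1 -> is_derive p v f2 d2 -> is_derive p v f3 d3 ->
  differentiable (fun q => quat (f0 q) (f1 q) (f2 q) (f3 q)) p /\
  'd (fun q => quat (f0 q) (f1 q) (f2 q) (f3 q)) p v = quat d0 d1 d2 d3.
Proof.
move=> D0 D1 D2 D3 [_ <-] [_ <-] [_ <-] [_ <-].
have qsum (a b c d : R) : quat a b c d = a *: quat 1 0 0 0 + b *: quat 0 1 0 0 +
    c *: quat 0 0 1 0 + d *: quat 0 0 0 1.
  by apply: quatP; rewrite !qE; ring.
have E : (fun q => quat (f0 q) (f1 q) (f2 q) (f3 q)) =
    (fun q => f0 q *: quat 1 0 0 0) + (fun q => f1 q *: quat 0 1 0 0) +
    (fun q => f2 q *: quat 0 0 1 0) + (fun q => f3 q *: quat 0 0 0 1).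
  by apply/funext => q; rewrite qsum.
rewrite E {E}.
have Z (f : V -> R) (x : H) : differentiable f p -> differentiable (fun q => f q *: x) p.
  exact: differentiableZl.
have Zd (f : V -> R) (x : H) : differentiable f p ->
    'd (fun q => f q *: x) p v = 'D_v f p *: x.
  by move=> df; rewrite (diffZl x df) (deriveE v df).
have A (F G : V -> H) (x y : H) : differentiable F p -> 'd F p v = x ->
    differentiable G p -> 'd G p v = y ->
    differentiable (F + G) p /\ 'd (F + G) p v = x + y.
  move=> dF Fx dG Gy; have dFG := differentiableD dF dG; split=> //.
  apply: (etrans (esym (deriveE v dFG))).
  apply: (etrans (deriveD (diff_derivable dF) (diff_derivable dG))).
  congr (_ + _).
  exact: (etrans (deriveE v dF) Fx).
  exact: (etrans (deriveE v dG) Gy).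
have [s1 e1] := A _ _ _ _ (Z _ (quat 1 0 0 0) D0) (Zd _ _ D0) (Z _ (quat 0 1 0 0) D1) (Zd _ _ D1).
have [s2 e2] := A _ _ _ _ s1 e1 (Z _ (quat 0 0 1 0) D2) (Zd _ _ D2).
have [s3 e3] := A _ _ _ _ s2 e2 (Z _ (quat 0 0 0 1) D3) (Zd _ _ D3).
by split; [exact: s3|rewrite e3 [RHS]qsum].
Qed.

Lemma complement_diff (p v : E1) : M1 p ->
  'd (@complement_map R) p v =
  (bggg_t p.1.1 *: v.1.2 + (rate p.1.1 * v.1.1) *: p.1.2,
   qmul v.1.2 (qconj p.2) + qmul p.1.2 (qconj v.2)).
Proof.
case=> hr _ _.
have cE : @complement_map R = fun q : E1 =>
  (quat (bggg_t q.1.1 * q0 q.1.2) (bggg_t q.1.1 * q1 q.1.2) (bggg_t q.1.1 * q2 q.1.2)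
        (bggg_t q.1.1 * q3 q.1.2),
   quat (q0 (qmul q.1.2 (qconj q.2))) (q1 (qmul q.1.2 (qconj q.2)))
        (q2 (qmul q.1.2 (qconj q.2))) (q3 (qmul q.1.2 (qconj q.2)))).
  by apply/funext => q; congr (_, _); apply: quatP; rewrite !qE.
have dt1 : differentiable (fun q : E1 => bggg_t q.1.1) p.
  apply: (@differentiable_comp _ _ _ _ (fun q : E1 => q.1.1) (@bggg_t R)).
    apply: (@differentiable_comp _ _ _ _ (@fst _ _) (@fst _ _)); exact: fst_differentiable.
  by apply/derivable1_diffP; case: (bggg_t_derive hr).
have ca i : differentiable (fun q : E1 => q.1.2 0 i) p.
  apply: coord_differentiable.
  apply: (@differentiable_comp _ _ _ _ (@fst _ _) (@snd _ _)).
    exact: fst_differentiable.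
  exact: snd_differentiable.
have cb i : differentiable (fun q : E1 => q.2 0 i) p.
  by apply: coord_differentiable; exact: snd_differentiable.
have da i : is_derive p v (fun q : E1 => q.1.2 0 i) (v.1.2 0 i).
  by apply: derive_affine => h /=; rewrite !mxE addrC.
have db i : is_derive p v (fun q : E1 => q.2 0 i) (v.2 0 i).
  by apply: derive_affine => h /=; rewrite !mxE addrC.
have dtv := radial_derive v (bggg_t_derive hr).
pose Dx (k : H -> R) := bggg_t p.1.1 * k v.1.2 + rate p.1.1 * v.1.1 * k p.1.2.
have [D1 e1] : differentiable (fun q : E1 => quat (bggg_t q.1.1 * q0 q.1.2)
    (bggg_t q.1.1 * q1 q.1.2) (bggg_t q.1.1 * q2 q.1.2) (bggg_t q.1.1 * q3 q.1.2)) p /\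
  'd (fun q : E1 => quat (bggg_t q.1.1 * q0 q.1.2)
    (bggg_t q.1.1 * q1 q.1.2) (bggg_t q.1.1 * q2 q.1.2) (bggg_t q.1.1 * q3 q.1.2)) p v =
  quat (Dx (@q0 R)) (Dx (@q1 R)) (Dx (@q2 R)) (Dx (@q3 R)).
  apply: diff_quat; try exact: (differentiableM dt1 (ca _));
  by apply: (derive_eq (derive_mul dtv (da _))); rewrite addrC.
have dqm (g : E1 -> R) (d c : R) : (forall h : R, g (h *: v + p) = g p + h * d + h * (h * c)) ->
    is_derive p v g d.
  by move=> E; apply: (@derive_cubic _ _ _ _ _ _ c 0) => h; rewrite E; ring.
pose X := qmul v.1.2 (qconj p.2) + qmul p.1.2 (qconj v.2).
pose Y := qmul v.1.2 (qconj v.2).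
have L (h : R) : qmul (h *: v + p).1.2 (qconj (h *: v + p).2) =
    qmul p.1.2 (qconj p.2) + h *: X + h *: (h *: Y).
  rewrite /X /Y /= qconjD qconjZ !(qmulDl, qmulDr, qmulZl, qmulZr).
  by apply: quatP; rewrite !qE; ring.
have d0 : is_derive p v (fun q : E1 => q0 (qmul q.1.2 (qconj q.2))) (q0 X).
  by apply: (dqm _ _ (q0 Y)) => h; rewrite L !qE.
have d1 : is_derive p v (fun q : E1 => q1 (qmul q.1.2 (qconj q.2))) (q1 X).
  by apply: (dqm _ _ (q1 Y)) => h; rewrite L !qE.
have d2 : is_derive p v (fun q : E1 => q2 (qmul q.1.2 (qconj q.2))) (q2 X).
  by apply: (dqm _ _ (q2 Y)) => h; rewrite L !qE.
have d3 : is_derive p v (fun q : E1 => q3 (qmul q.1.2 (qconj q.2))) (q3 X).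
  by apply: (dqm _ _ (q3 Y)) => h; rewrite L !qE.
have [D2 e2] : differentiable (fun q : E1 => quat (q0 (qmul q.1.2 (qconj q.2)))
    (q1 (qmul q.1.2 (qconj q.2))) (q2 (qmul q.1.2 (qconj q.2))) (q3 (qmul q.1.2 (qconj q.2)))) p /\
  'd (fun q : E1 => quat (q0 (qmul q.1.2 (qconj q.2)))
    (q1 (qmul q.1.2 (qconj q.2))) (q2 (qmul q.1.2 (qconj q.2))) (q3 (qmul q.1.2 (qconj q.2)))) p v =
  quat (q0 X) (q1 X) (q2 X) (q3 X).
  apply: diff_quat => //; rewrite /qmul /qconj; under eq_fun do rewrite !quatE;
    by do ![apply: differentiableD|apply: differentiableB|apply: differentiableM|
            apply: differentiableN|exact: ca|exact: cb].
rewrite cE; apply: (etrans (congr1 (fun k : E1 -> E2 => k v) (diff_pair D1 D2))).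
apply: (etrans (congr2 pair e1 e2)); rewrite quat_eta; congr (_, _).
by apply: quatP; rewrite !qE.
Qed.

(** The tangent vectors of M_1 at (r, a, b) are the (rho, a X, b Y) with X and Y
    imaginary.  In these terms, the differential of the map to R^4 x S^3 takes
    values of the form (a Xi, a Z b^-1), and all products below reduce to
    products of Xi, X, Y by cancelling a and b. *)
Definition tangent_at (p : E1) (rho : R) (X Y : H) : E1 :=
  (rho, qmul p.1.2 X, qmul p.2 Y).

Lemma tangentP (p v : E1) : M1 p -> T1 p v -> exists X Y : H,
  [/\ q0 X = 0, q0 Y = 0 & v = tangent_at p v.1.1 X Y].
Proof.
case=> _ a1 b1 [av bv].
exists (qmul (qconj p.1.2) v.1.2), (qmul (qconj p.2) v.2); rewrite -!qdotE; split=> //.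
rewrite /tangent_at !qmulA !qmul_conjr // !qmul1l.
by case: v {av bv} => -[].
Qed.

(** The quaternion Xi with dx = a Xi, where x = t a. *)
Definition push_fst (p : E1) (rho : R) (X : H) : H :=
  bggg_t p.1.1 *: X + (rate p.1.1 * rho) *: qone.

Lemma complement_diff_tangent (p : E1) (rho : R) (X Y : H) : M1 p ->
  'd (@complement_map R) p (tangent_at p rho X Y) =
  (qmul p.1.2 (push_fst p rho X), qmul (qmul p.1.2 (X + qconj Y)) (qconj p.2)).
Proof.
move=> Mp; rewrite complement_diff // /tangent_at /push_fst /=; congr (_, _).
  by rewrite !(qmulDr, qmulZr) qmul1.
by rewrite !(qmulDl, qmulDr) qconjM -!qmulA.
Qed.

End ComplementMap.

Section Pullback.
Variable R : realType.
Local Notation E1 := (E1 R).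
Local Notation E2 := (E2 R).
Local Notation H := ('rV[R]_4).
Variables (p : E1) (Mp : M1 p).
Let a := p.1.2.
Let b := p.2.
Let t := bggg_t p.1.1.
Let P := complement_map p.
Let a1 : qdot a a = 1. Proof. by case: Mp. Qed.
Let b1 : qdot b b = 1. Proof. by case: Mp. Qed.

Let PE : P.1 = qmul a (t *: qone). Proof. by rewrite qmulZr qmul1. Qed.

(** The cancellation that makes the result independent of a and b. *)
Let conj_move (Z W U : H) :
  qmul (qmul (qmul (qmul a Z) (qconj b)) (qconj (qmul (qmul a W) (qconj b)))) (qmul a U) =
  qmul a (qmul (qmul Z (qconj W)) U).
Proof.
rewrite !qconjM qconjK -!qmulA (qmulA (qconj b)) qmul_conjl // qmul1l.
by rewrite (qmulA (qconj a)) qmul_conjl // qmul1l.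
Qed.

Let P2 : P.2 = qmul (qmul a qone) (qconj b). Proof. by rewrite qmul1. Qed.

Lemma norm_complement : qdot P.1 P.1 = t ^+ 2.
Proof.
rewrite -[RHS]mulr1 -a1 /P /= /qdot !qE /a /t; ring.
Qed.

Variables (rho : R) (X Y : H) (X0 : q0 X = 0) (Y0 : q0 Y = 0).
Let V := 'd (@complement_map R) p (tangent_at p rho X Y).

Let VE : V = (qmul a (push_fst p rho X), qmul (qmul a (X + qconj Y)) (qconj b)).
Proof. exact: complement_diff_tangent. Qed.

Lemma qdot_pushforward : qdot P.1 V.1 = t * (rate p.1.1 * rho).
Proof.
rewrite qdotE PE VE /= qconjM -qmulA (qmulA (qconj a)) qmul_conjl // qmul1l.
by rewrite /push_fst /qmul /qconj /qone !qE X0; ring.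
Qed.

Lemma alpha_pushforward : alpha P V = t ^+ 2 * ep1_bil p (tangent_at p rho X Y).
Proof.
rewrite /alpha /ep1_bil P2 PE VE /= conj_move !im1_mull //.
have E (x y : H) : qdot x x = 1 -> im1 x (qmul x y) = q1 y.
  by move=> x1; rewrite /im1 qmulA qmul_conjl // qmul1l.
rewrite !E // ?qconj1 !(qmulZr, qmul1, im1Zr, im1Zl, im1_one) /push_fst /qconj /qone !qE -/t.
by field.
Qed.

Variables (rho' : R) (X' Y' : H) (X0' : q0 X' = 0) (Y0' : q0 Y' = 0).
Let W := 'd (@complement_map R) p (tangent_at p rho' X' Y').

Let WE : W = (qmul a (push_fst p rho' X'), qmul (qmul a (X' + qconj Y')) (qconj b)).
Proof. exact: complement_diff_tangent. Qed.

Lemma dalpha_pushforward : dalpha P V W =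
  im1 (push_fst p rho X) (push_fst p rho' X') - 2^-1 * (
    t * im1 (push_fst p rho X) (X' + qconj Y') +
    t ^+ 2 * q1 (qmul (X' + qconj Y') (qconj (X + qconj Y))) +
    t * q1 (qmul (X' + qconj Y') (push_fst p rho X))).
Proof.
rewrite /dalpha P2 PE VE WE /= !conj_move !im1_mull //.
rewrite qconj1 !(qmulZr, qmul1, im1Zr, im1Zl, im1_one) qZ -/t; ring.
Qed.

End Pullback.

(** * The equation on the total space *)

Section Transfer.
Variable R : realType.
Local Notation E1 := (E1 R).
Local Notation E2 := (E2 R).
Local Notation H := ('rV[R]_4).

(** The exterior derivative of t^2 eta_1^+, computed on the total space. *)
Lemma dalpha_antisym (p : E1) (rho rho' : R) (X Y X' Y' : H) : M1 p ->
  q0 X = 0 -> q0 Y = 0 -> q0 X' = 0 -> q0 Y' = 0 ->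
  let v := tangent_at p rho X Y in let w := tangent_at p rho' X' Y' in
  let P := complement_map p in let t := bggg_t p.1.1 in
  dalpha P ('d (@complement_map R) p v) ('d (@complement_map R) p w) -
  dalpha P ('d (@complement_map R) p w) ('d (@complement_map R) p v) =
  2 * t * rate p.1.1 * (rho * ep1_bil p w - rho' * ep1_bil p v) +
  t ^+ 2 * (ep1_bil v w - ep1_bil w v).
Proof.
move=> Mp X0 Y0 X0' Y0' v w P t.
rewrite /v /w !dalpha_pushforward // /ep1_bil /tangent_at /=.
have [_ a1 b1] := Mp.
have E (x y : H) : qdot x x = 1 -> im1 x (qmul x y) = q1 y.
  by move=> x1; rewrite /im1 qmulA qmul_conjl // qmul1l.
rewrite !im1_mull // !E // /push_fst !im1E /qmul /qconj /qone !qE X0 Y0 X0' Y0' -/t.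
by field.
Qed.

(** Both sides are the curvature of f eta_1^+; on the left it is computed on the
    total space, where dG comes with d(t^2), and the derivatives of
    f = G (t^2) t^2 are compared. *)
Lemma curvature_pushforward (p : E1) (g G : R -> R) (v : 'I_2 -> E1) (dg dG : R) :
  M1 p -> (forall i, T1 p (v i)) ->
  is_derive p.1.1 1 g dg -> is_derive (bggg_t p.1.1 ^+ 2) 1 G dG ->
  (forall r, 9 / 4 < r -> g r = G (bggg_t r ^+ 2) * bggg_t r ^+ 2) ->
  extd (extension G) (complement_map p) (fun i => 'd (@complement_map R) p (v i)) =
  extd (connection g) p v.
Proof.
move=> Mp Tv Dg DG gE.
have hr : 9 / 4 < p.1.1 by case: Mp.
have Dt := bggg_t_derive hr.
have Dtt : is_derive p.1.1 1 (fun r : R => bggg_t r ^+ 2) (2 * bggg_t p.1.1 * rate p.1.1).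
  by apply: (derive_eq (derive_mul Dt Dt)); ring.
have Dg' : is_derive p.1.1 1 g (dG * (2 * bggg_t p.1.1 * rate p.1.1) * bggg_t p.1.1 ^+ 2 +
    G (bggg_t p.1.1 ^+ 2) * (2 * bggg_t p.1.1 * rate p.1.1)).
  apply: near_eq_is_derive (derive_mul (derive_comp Dtt DG) Dtt).
  by apply: filterS (near_above hr) => r hx; rewrite gE.
have dgE : dg = dG * (2 * bggg_t p.1.1 * rate p.1.1) * bggg_t p.1.1 ^+ 2 +
    G (bggg_t p.1.1 ^+ 2) * (2 * bggg_t p.1.1 * rate p.1.1).
  by case: Dg => _ <-; case: Dg' => _ <-.
have DG' : is_derive (qdot (complement_map p).1 (complement_map p).1) 1 G dG.
  by rewrite norm_complement.
rewrite (curvature_eval v Dg) (extd_extension _ DG') norm_complement // {DG'}.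
have [X [Y [X0 Y0 ->]]] := tangentP Mp (Tv ord0).
have [X' [Y' [X0' Y0' ->]]] := tangentP Mp (Tv (lift ord0 ord0)).
rewrite !qdot_pushforward // !alpha_pushforward // dalpha_antisym // gE // dgE /=.
move: (ep1_bil _ _) (ep1_bil _ _) (ep1_bil _ _) (ep1_bil _ _) => e1 e2 e3 e4.
ring.
Qed.

Lemma extension_extends (g G : R -> R) :
  (forall r, 9 / 4 < r -> g r = G (bggg_t r ^+ 2) * bggg_t r ^+ 2) ->
  extends_form (extension G) (connection g).
Proof.
move=> gE p Mp v Tv; have hr : 9 / 4 < p.1.1 by case: Mp.
rewrite /pullback /extension /connection /fmul ep1E -/(ep1_bil p (v 0)) norm_complement //.
have [X [Y [X0 Y0 ->]]] := tangentP Mp (Tv 0).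
by rewrite alpha_pushforward // gE // mulrA.
Qed.

Lemma q0_mulC (x y : H) : q0 (qmul x y) = q0 (qmul y x).
Proof. by rewrite /qmul !quatE; ring. Qed.

Lemma imag_conj_sub (x z : H) : q0 x = 0 -> q0 z = 0 -> x + qconj (x - z) = z.
Proof. by move=> x0 z0; apply: quatP; rewrite /qconj !qE ?x0 ?z0; ring. Qed.

(** The inverse of (r, a, b) |-> (t a, a b^-1) off the zero section: t = |x|,
    a = x / t, b = q^-1 a.  A tangent vector (xi, kappa) comes from rho, X, Y with
    t X + (dt/dr) rho = a^-1 xi and X - Y = a^-1 kappa b. *)
Lemma complement_surj (Q : E2) : M2 Q -> Q.1 != 0 ->
  exists p : E1, [/\ M1 p, complement_map p = Q &
    forall V, T2 Q V -> exists2 v, T1 p v & 'd (@complement_map R) p v = V].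
Proof.
move=> MQ Q0.
have n0 : 0 < qdot Q.1 Q.1.
  rewrite lt0r; apply/andP; split; last by rewrite /qdot -!expr2 !addr_ge0 ?sqr_ge0.
  apply: contra Q0; rewrite /qdot -!expr2 => /eqP E; apply/eqP.
  have s0 := sqr_ge0 (q0 Q.1); have s1 := sqr_ge0 (q1 Q.1).
  have s2 := sqr_ge0 (q2 Q.1); have s3 := sqr_ge0 (q3 Q.1).
  have z (x : R) : x ^+ 2 = 0 -> x = 0 by move=> /eqP; rewrite sqrf_eq0 => /eqP.
  by rewrite -(scale0r Q.1); apply: quatP; rewrite qZ mul0r; apply: z; lra.
have [r hr tE] := bggg_t_surj n0.
set t := bggg_t r in tE.
have t0 : 0 < t by rewrite /t bggg_tE ?ltW // dist_gt0.
have tn0 : t != 0 by rewrite gt_eqF.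
have rate0 : rate r != 0.
  by rewrite gt_eqF // sqrtr_gt0 divr_gt0 ?mulr_gt0 //; lra.
pose a := t^-1 *: Q.1; pose b := qmul (qconj Q.2) a.
have a1 : qdot a a = 1.
  rewrite -[RHS](@divff _ (t ^+ 2)) ?expf_neq0 // {1}tE /a /qdot !qE; field.
  exact: tn0.
have b1 : qdot b b = 1.
  rewrite qdotE /b qconjM qconjK -qmulA (qmulA Q.2) qmul_conjr // qmul1l -qdotE //.
have Mp : M1 (r, a, b) by [].
have QE : complement_map (r, a, b) = Q.
  rewrite /complement_map /= /b qconjM qconjK qmulA qmul_conjr // qmul1l.
  by rewrite /a scalerA divff // scale1r; case: (Q).
exists (r, a, b); split=> // V TV.
pose Z := qmul (qconj a) (qmul V.2 b).
have Z0 : q0 Z = 0.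
  rewrite /Z /b q0_mulC -!qmulA qmul_conjr // qmul1 q0_mulC -qdotE.
  exact: TV.
clearbody b; pose Xi := qmul (qconj a) V.1.
pose rho := q0 Xi / rate r.
pose X := t^-1 *: quat 0 (q1 Xi) (q2 Xi) (q3 Xi).
pose Y := X - Z.
have X0 : q0 X = 0 by rewrite /X !qE mulr0.
have Y0 : q0 Y = 0 by rewrite /Y qD qN X0 Z0 subrr.
exists (tangent_at (r, a, b) rho X Y).
  by split; rewrite /tangent_at /= qdotE qmulA qmul_conjl // qmul1l.
rewrite complement_diff_tangent // /push_fst /= -/t.
have -> : t *: X + (rate r * rho) *: qone = Xi.
  by apply: quatP; rewrite /X /rho /qone !qE; field; rewrite ?tn0 ?rate0.
have -> : X + qconj Y = Z.
  by rewrite /Y imag_conj_sub.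
rewrite /Xi /Z !qmulA qmul_conjr // !qmul1l -qmulA qmul_conjr // qmul1.
by case: (V).
Qed.

End Transfer.

Section ZeroSection.
Variable R : realType.
Local Notation E2 := (E2 R).

Lemma continuous_bigsum (V : normedModType R) (I : Type) (s : seq I) (F : I -> V -> R) :
  (forall i, continuous (F i)) -> continuous (fun p => \sum_(i <- s) F i p).
Proof.
move=> cF; elim: s => [|i s IH] p.
  by under eq_fun do rewrite big_nil; exact: cst_continuous.
by under eq_fun do rewrite big_cons; apply: cvgD; [exact: cF|exact: IH].
Qed.

Definition continuous_form (V : normedModType R) k (w : form V k) : Prop :=
  forall v, continuous (w ^~ v).

Lemma continuous_wedge (V : normedModType R) k l (a : form V k) (b : form V l) :
  continuous_form a -> continuous_form b -> continuous_form (a \wedge b).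
Proof.
move=> ca cb v p; rewrite /wedge; apply: cvgM; first exact: cvg_cst.
apply: continuous_bigsum => s q; apply: cvgM; last exact: cb.
by apply: cvgM; [exact: cvg_cst|exact: ca].
Qed.

Lemma continuous_extd (V : normedModType R) k (w : form V k) :
  smooth_form w -> continuous_form (extd w).
Proof.
move=> [_ sw] v p; rewrite /extd; apply: continuous_bigsum => i q.
apply: cvgM; first exact: cvg_cst.
by have [c _] := sw (fun j => v (lift i j)) [:: v i]; exact: c.
Qed.

(** Approach (0, q) along (h e, q), h -> 0, for a fixed e <> 0. *)
Lemma vanish_on_zero_section (Phi : E2 -> R) (q : 'rV[R]_4) : continuous Phi ->
  (forall x, x != 0 -> Phi (x, q) = 0) -> Phi (0, q) = 0.
Proof.
move=> cPhi Phi0.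
pose e : 'rV[R]_4 := qone.
have e0 : e != 0.
  apply/eqP => /(congr1 (@q0 R)); rewrite /e /qone quatE /q0 mxE => /eqP.
  by rewrite oner_eq0.
have cp : {for (0 : R), continuous (fun h : R => (h *: e, q) : E2)}.
  apply: differentiable_continuous; apply: differentiable_pair.
    exact: differentiableZl.
  exact: differentiable_cst.
have cv : Phi (h *: e, q) @[h --> (0 : R)] --> Phi (0, q) 
  by rewrite -[0 in X in _ --> X](scale0r e); exact: (cvg_comp _ _ cp (cPhi _)).
have cv' : Phi (h *: e, q) @[h --> (0 : R)^'] --> Phi (0, q).
  by apply: cvg_trans cv; apply: cvg_app; exact: cvg_within.
have c0 : Phi (h *: e, q) @[h --> (0 : R)^'] --> (0 : R).
  have cc : (0 : R) @[h --> (0 : R)^'] --> (0 : R) by exact: cvg_cst.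
  apply: cvg_trans cc; apply: near_eq_cvg; near=> h.
  rewrite Phi0 // scaler_eq0 (negbTE e0) orbF.
  by near: h; exact: nbhs_dnbhs_neq.
exact: (cvg_unique (@norm_hausdorff _ _) cv' c0).
Unshelve. all: by end_near. Qed.

End ZeroSection.

(** Off the zero section, the wedge products on the two sides agree because their
    factors agree on vectors that correspond to each other.  On it, the
    equation follows by continuity, at a fixed q and fixed tangent vectors. *)
Lemma instanton_on_total_space (R : realType) (f G : R -> R) (s0 : R)
    (psi : form (E2 R) 4) :
  deformed_G2_instanton (@M1 R) (@T1 R) (@bggg_psi R) (connection f) ->
  s0 < 0 -> smooth_on (above s0) G ->
  (forall r : R, 9 / 4 < r -> f r = G (bggg_t r ^+ 2) * bggg_t r ^+ 2) ->
  (forall r : R, 9 / 4 < r -> derivable f r 1) ->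
  smooth_form psi -> extends_form psi (@bggg_psi R) ->
  deformed_G2_instanton (@M2 R) (@T2 R) psi (extension G).
Proof.
move=> inst s00 sG fG df spsi epsi F [x q] MQ v Tv.
have sA := smooth_extension s00 sG.
have cF : continuous_form F by exact: continuous_extd.
have cpsi : continuous_form psi by move=> u; have [c _] := spsi.2 u [::].
pose Phi : E2 R -> R :=
  (fsub (fmul (cst 6^-1) (wedge (wedge F F) F : form (E2 R) 6)) (wedge F psi))^~ v.
have cPhi : continuous Phi.
  move=> P; apply: cvgB; last exact: (continuous_wedge cF cpsi).
  apply: cvgM; first exact: cvg_cst.
  exact: (continuous_wedge (continuous_wedge cF cF) cF).
have key y : y != 0 -> Phi (y, q) = 0.
  move=> y0.
  have MQ' : M2 (y, q) by [].
  have [p [Mp pE lift_]] := complement_surj MQ' y0.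
  have hr : 9 / 4 < p.1.1 by case: Mp.
  have /choice[u hu] : forall i, exists u, T1 p u /\ 'd (@complement_map R) p u = v i.
    by move=> i; have [|u Tu Eu] := lift_ (v i); [exact: Tv|exists u].
  have vE : v = fun i => 'd (@complement_map R) p (u i).
    by apply/funext => i; rewrite (hu i).2.
  have Tu i : T1 p (u i) by case: (hu i).
  rewrite -(inst p Mp u Tu) /Phi vE -pE.
  have [G' _ dG] := smooth_on_derive sG.
  have DG : is_derive (bggg_t p.1.1 ^+ 2) 1 G (G' (bggg_t p.1.1 ^+ 2)).
    by apply: dG; apply: (lt_le_trans s00); exact: sqr_ge0.
  have FE (w : 'I_2 -> E1 R) : (forall i, T1 p (w i)) ->
      F (complement_map p) (fun i => 'd (@complement_map R) p (w i)) = extd (connection f) p w.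
    by move=> Tw; exact: (curvature_pushforward Mp Tw (derivableP (df _ hr)) DG fG).
  have PE (w : 'I_4 -> E1 R) : (forall i, T1 p (w i)) ->
      psi (complement_map p) (fun i => 'd (@complement_map R) p (w i)) = bggg_psi p w.
    by move=> Tw; exact: epsi.
  have WE k l (A1 : form (E2 R) k) (A2 : form (E1 R) k) (B1 : form (E2 R) l) (B2 : form (E1 R) l) :
     (forall w, (forall i, T1 p (w i)) ->
        A1 (complement_map p) (fun i => 'd (@complement_map R) p (w i)) = A2 p w) ->
     (forall w, (forall i, T1 p (w i)) ->
        B1 (complement_map p) (fun i => 'd (@complement_map R) p (w i)) = B2 p w) ->
     forall w, (forall i, T1 p (w i)) ->
      (A1 \wedge B1) (complement_map p) (fun i => 'd (@complement_map R) p (w i)) =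
      (A2 \wedge B2) p w.
    move=> HA HB w Tw; rewrite /wedge; congr (_ * _); apply: eq_bigr => s _.
    by rewrite HA ?HB.
  rewrite /fsub /fmul; congr (_ * _ - _).
    by apply: (WE) => //; exact: (WE).
  exact: (WE).
have [x0|] := eqVneq x 0; last exact: key.
by rewrite x0; exact: (vanish_on_zero_section cPhi key).
Qed.

Theorem theorem4p2 (R : realType) :
  (forall c : R, 0 < c < pi / 2 ->
     exists2 g : R -> R, is_profile c g &
       forall h, is_profile c h -> forall r, 9 / 4 <= r -> h r = g r) /\
  forall f : R -> R -> R,
    (forall c, 0 < c < pi / 2 -> is_profile c (f c)) ->
    (forall c, 0 < c < pi / 2 ->
       (* the equation on the complement of the zero section *)
       deformed_G2_instanton (@M1 R) (@T1 R) (@bggg_psi R)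
         (connection (f c)) /\
       (* A_c is a smooth deformed G_2-instanton on R^4 x S^3 *)
       exists2 A : form (E2 R) 1,
         smooth_form A /\ extends_form A (connection (f c)) &
         forall (phi : form (E2 R) 3) (psi : form (E2 R) 4),
           BGGG_structure phi psi ->
           deformed_G2_instanton (@M2 R) (@T2 R) psi A) /\
    {uniform [set r | 9 / 4 <= r], f @ at_left (pi / 2) --> cst 0}.
Proof.
split=> [c hc|f hf].
  have [g [_ [_ [pg _ _ _ _]]]] := profile_radial hc.
  by exists g => // h ph r hr; exact: profile_unique hc ph pg r hr.
split; last exact: profile_uniform.
move=> c hc; have pf := hf c hc.
have inst := instanton_on_complement hc pf.
split=> //.
have [g [s0 [G [pg s00 sG gG dg]]]] := profile_radial hc.
have fg r : 9 / 4 <= r -> f c r = g r by exact: profile_unique hc pf pg r.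
have fG (r : R) : 9 / 4 < r -> f c r = G (bggg_t r ^+ 2) * bggg_t r ^+ 2.
  by move=> hr; rewrite fg ?gG // ltW.
exists (extension G).
  by split; [exact: smooth_extension s00 sG|exact: extension_extends].
move=> phi psi [_ spsi _ epsi].
apply: (instanton_on_total_space inst s00 sG fG _ spsi epsi) => r hr.
have [d dd _] := dg r hr.
have [] // : is_derive r 1 (f c) d.
apply: near_eq_is_derive dd.
by apply: filterS (near_above hr) => x hx; rewrite fg // ltW.
Qed.
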